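(* Let $m\ge2$, let $k_0:=\left\lfloor\frac{m+2}2\right\rfloor$, and put $s_1=\infty$ and $$s_k=\begin{cases}\frac m{k-1}, & \text{if } 1<k\le k_0,\\ 2, & \text{if } k>k_0.\end{cases}$$ There exists a constant $C_m$, depending only on $m$, such that $$\left(\sum_{j_1=1}^n\left(\cdots\left(\sum_{j_m=1}^n|A(e_{j_1},\ldots,e_{j_m})|^{s_m}\right)^{\frac{s_{m-1}}{s_m}}\cdots\right)^{\frac{s_1}{s_2}}\right)^{\frac1{s_1}}\le C_m\|A\|$$ for all positive integers $n$ and all $m$-linear forms $A\colon\ell_m^n\times\cdots\times\ell_m^n\to\mathbb K$. Moreover, the exponents $s_1,\ldots,s_{k_0}$ are sharp, and $(s_1,\ldots,s_m)$ is globally sharp.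
   Context: $\mathbb K=\mathbb R$ or $\mathbb C$; $\ell_m^n$ is $\mathbb K^n$ with the $\ell_m$ norm ($p=m$); $e_j$ are the canonical unit vectors. For an $m$-linear form $A\colon\ell_m^n\times\cdots\times\ell_m^n\to\mathbb K$, $\|A\|:=\sup\{|A(z^{(1)},\ldots,z^{(m)})|:\ \|z^{(j)}\|_{\ell_m^n}\le 1,\ j=1,\ldots,m\}$. When an exponent equals $\infty$, the corresponding $\left(\sum_j|a_j|^s\right)^{1/s}$ denotes $\sup_j|a_j|$; thus the left-hand side of the inequality is $\sup_{j_1}\left(\sum_{j_2=1}^n\left(\cdots\left(\sum_{j_m=1}^n|A(e_{j_1},\ldots,e_{j_m})|^{s_m}\right)^{\frac{s_{m-1}}{s_m}}\cdots\right)^{\frac{s_2}{s_3}}\right)^{\frac1{s_2}}$. Call $(t_1,\ldots,t_m)\in(0,\infty]^m$ admissible if there is a constant $C$ (not depending on $n$ or $A$) such that $$\left(\sum_{j_1=1}^n\left(\cdots\left(\sum_{j_m=1}^n|A(e_{j_1},\ldots,e_{j_m})|^{t_m}\right)^{\frac{t_{m-1}}{t_m}}\cdots\right)^{\frac{t_1}{t_2}}\right)^{\frac1{t_1}}\le C\|A\|$$ (iterated $\ell_{t_m},\ldots,\ell_{t_1}$ norms, with suprema for infinite exponents) for all positive integers $n$ and all $m$-linear forms $A\colon\ell_m^n\times\cdots\times\ell_m^n\to\mathbb K$. The exponent $s_k$ at position $k$ is sharp (optimal) if every admissible $(t_1,\ldots,t_m)$ satisfies $t_k\ge s_k$. An $m$-tuple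 $(t_1,\ldots,t_m)$ is globally sharp if it is admissible and, for every $j\in\{1,\ldots,m\}$ and every $0<t_j'<t_j$, the $m$-tuple $(t_1,\ldots,t_{j-1},t_j',t_{j+1},\ldots,t_m)$ is not admissible. *)

(* Defs.v *)
From HB Require Import structures.
From mathcomp Require Import all_boot all_order all_algebra.
From mathcomp Require Import all_classical all_reals all_analysis.
From mathcomp Require Import complex.
Set Implicit Arguments.
Unset Strict Implicit.
Unset Printing Implicit Defensive.
Import Order.TTheory GRing.Theory Num.Theory.
Local Open Scope ring_scope.
Local Open Scope classical_set_scope.

Variant scalars := Reals | Complexes.

Definition scalar_type (R : realType) (F : scalars) : fieldType :=
  match F with Reals => R | Complexes => complex R end.

(* The norm of complex R takes its values in complex R; its real part is the
   modulus as an element of R. *)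
Definition modulus (R : realType) (F : scalars) : scalar_type R F -> R :=
  match F return scalar_type R F -> R with
  | Reals => fun x : R => `|x|
  | Complexes => fun z : complex R => complex.Re `|z|
  end.

(* Meaningful for 0 < t; the -oo branch is never used. *)
Definition lnorm (R : realType) (n : nat) (t : \bar R) (x : 'I_n -> R) : R :=
  match t with
  | r%:E => (\sum_(j < n) `|x j| `^ r) `^ r^-1
  | +oo%E => \big[Num.max/0]_(j < n) `|x j|
  | -oo%E => 0
  end.

(* Iterated norm of an m-fold array: the first index carries the outermost
   norm, with exponent t ord0. *)
Fixpoint mixed_norm (R : realType) (n m : nat) :
    ('I_m -> \bar R) -> (m.-tuple 'I_n -> R) -> R :=
  match m with
  | 0 => fun _ a => a [tuple]
  | m'.+1 => fun t a =>
      lnorm (t ord0) (fun j : 'I_n =>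
        mixed_norm (fun i : 'I_m' => t (lift ord0 i))
                   (fun js : m'.-tuple 'I_n => a [tuple of j :: js]))
  end.

Section Forms.
Variables (R : realType) (K : fieldType) (abs : K -> R).

Definition multilinear_form (m n : nat) (A : ('I_m -> 'rV[K]_n) -> K) : Prop :=
  forall (i : 'I_m) (z : 'I_m -> 'rV[K]_n) (c : K) (u v : 'rV[K]_n),
    A [eta z with i |-> c *: u + v] =
    c * A [eta z with i |-> u] + A [eta z with i |-> v].

Definition vnorm (n : nat) (p : \bar R) (x : 'rV[K]_n) : R :=
  lnorm p (fun j => abs (x 0 j)).

(* The set is nonempty, and bounded when A is multilinear, so that the real
   supremum is the actual least upper bound. *)
Definition form_norm (m n : nat) (A : ('I_m -> 'rV[K]_n) -> K) : R :=
  sup [set r | exists2 z : 'I_m -> 'rV[K]_n,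
                 (forall j, vnorm m%:R%:E (z j) <= 1) & r = abs (A z)].

Definition form_coef (m n : nat) (A : ('I_m -> 'rV[K]_n) -> K)
    (js : m.-tuple 'I_n) : R :=
  abs (A (fun i => delta_mx 0 (tnth js i))).

Definition admissible (m : nat) (t : 'I_m -> \bar R) : Prop :=
  (forall i, (0 < t i)%E) /\
  exists C : R, forall n : nat, (0 < n)%N ->
    forall A : ('I_m -> 'rV[K]_n) -> K, multilinear_form A ->
      mixed_norm t (form_coef A) <= C * form_norm A.

Definition sharp_at (m : nat) (s : 'I_m -> \bar R) (k : 'I_m) : Prop :=
  forall t : 'I_m -> \bar R, admissible t -> (s k <= t k)%E.

Definition globally_sharp (m : nat) (t : 'I_m -> \bar R) : Prop :=
  admissible t /\
  forall (j : 'I_m) (t' : \bar R), (0 < t')%E -> (t' < t j)%E ->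
    ~ admissible [eta t with j |-> t'].

End Forms.

Definition k0 (m : nat) : nat := (m + 2) %/ 2.

(* Positions are numbered from 0: i : 'I_m is the position k = i.+1, hence
   k - 1 = i. *)
Definition s_exp (R : realType) (m : nat) (i : 'I_m) : \bar R :=
  if (i == 0 :> nat)%N then +oo%E
  else if (i.+1 <= k0 m)%N then (m%:R / i%:R)%:E
  else (2%:R : R)%:E.

(* Main.v *)
Require Import Defs.
From mathcomp Require Import all_boot all_order all_algebra.
From mathcomp Require Import all_classical all_reals all_analysis.
From mathcomp Require Import complex zify ring lra.
Set Implicit Arguments.
Unset Strict Implicit.
Unset Printing Implicit Defensive.
Import Order.TTheory GRing.Theory Num.Theory.
Local Open Scope ring_scope.

(** The left-hand side is a supremum over [j_1], so fixing the first argument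
    reduces the inequality to forms in the last [m - 1] variables, and more
    generally one bounds forms in the last [d] variables by induction on [d],
    from [d = m - k_0 + 1] up to [m - 1].

    When [d = m - k_0 + 1], the reciprocals of [d - 1] of the exponents still add up
    to less than [1/2], and the classical Hardy-Littlewood argument applies
    ([hardy_littlewood]).  On the cube, duality in one variable and Khinchine's
    inequality in the others give the mixed (l_1, l_2) Littlewood inequality
    ([mixed_littlewood]).  Multiplying the form by weights in the unit
    ball of [l_m] and removing the weights one variable at a time turns the outer
    exponent [m/(m-k)] into [m/(m-k-1)]: by duality if the weight belongs to the
    outer variable ([marginal_step_in]), and by a Hoelder interpolation between
    two outer variables otherwise ([hardy_littlewood_transfer]).  This yields the
    exponents [(s_{k_0}, 2, ..., 2)].

    Adding one more variable in front ([inequality_step]) uses that an iterated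
    norm with nonincreasing exponents in [[2, q]] has cotype [q] with constant 1
    ([mixed_norm_cotype]): averaging over random signs in the new variable bounds
    the [l_q] sum of the slices weighted by any [y] in the ball of [l_m], and
    duality gains [1/s_{k-1} = 1/s_k - 1/m], which is how the exponents [m/(k-1)]
    arise.

    Sharpness is witnessed by two explicit families of forms.  The diagonal form in
    the variables [k, ..., m] has norm at most [n^((k-1)/m)], while its array of
    coefficients has mixed norm [n^(1/t_k)] ([diagonal_sharp]).  For a position [b]
    beyond [k_0] one couples, by a Sylvester sign matrix, the variable [b] with the
    diagonal of the other variables at positions at least [k_0]; the orthogonality
    of the matrix makes the norm at most [n^(1/2 + 1/s_{k_0})], while the mixed norm
    of the coefficients is [n^(1/s_{k_0} + 1/t_b)], whence [t_b >= 2]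
    ([sylvester_sharp]). *)

(** * Finite inequalities for real powers *)

Section Inequalities.
Variable R : realType.
Implicit Types (t u v p q s x y : R).

Lemma young_powR t u v : 0 <= t <= 1 -> 0 <= u -> 0 <= v ->
  u `^ t * v `^ (1 - t) <= t * u + (1 - t) * v.
Proof.
move=> /andP[t0 t1] u0 v0.
have [->|tN0] := eqVneq t 0; first by rewrite subr0 powRr0 powRr1// !mul1r mul0r add0r.
have [->|tN1] := eqVneq t 1; first by rewrite subrr powRr0 powRr1// mul1r mul0r addr0 mulr1.
have tp : 0 < t by rewrite lt0r tN0.
have tq : 0 < 1 - t by rewrite subr_gt0 lt_neqAle tN1.
have /= := @conjugate_powR R (u `^ t) (v `^ (1 - t)) t^-1 (1 - t)^-1
  (powR_ge0 _ _) (powR_ge0 _ _).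
rewrite !invr_gt0 !invrK tp tq addrCA subrr addr0.
move=> h; apply: (le_trans (h isT isT erefl)).
by rewrite -!powRrM !mulfV ?gt_eqF// !powRr1// mulrC [v * _]mulrC.
Qed.

Lemma powR_sum_eq0 (I : finType) (P : pred I) (u : I -> R) (i : I) :
  (forall i, 0 <= u i) -> \sum_(i | P i) u i = 0 -> P i -> u i = 0.
Proof.
move=> u0 /eqP; rewrite psumr_eq0// => /allP/(_ i); rewrite mem_index_enum.
by move=> /(_ isT)/implyP h /h/eqP.
Qed.

(** Written with [u^t v^(1-t)] so that one statement serves Hoelder's inequality
    with weights, power means and interpolation of exponents. *)
Lemma hoelder_sum (I : finType) (P : pred I) (u v : I -> R) t :
  0 <= t <= 1 -> (forall i, 0 <= u i) -> (forall i, 0 <= v i) ->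
  \sum_(i | P i) u i `^ t * v i `^ (1 - t) <=
  (\sum_(i | P i) u i) `^ t * (\sum_(i | P i) v i) `^ (1 - t).
Proof.
move=> t01 u0 v0; have /andP[t0 t1] := t01.
have [->|tN0] := eqVneq t 0.
  rewrite subr0 powRr0 mul1r powRr1 ?sumr_ge0//.
  by apply: ler_sum => i _; rewrite powRr0 mul1r powRr1.
have [->|tN1] := eqVneq t 1.
  rewrite subrr powRr0 mulr1 powRr1 ?sumr_ge0//.
  by apply: ler_sum => i _; rewrite powRr0 mulr1 powRr1.
set A := \sum_(i | P i) u i; set B := \sum_(i | P i) v i.
have tN1' : 1 - t != 0 by rewrite subr_eq0 eq_sym.
have [A0|AN0] := eqVneq A 0.
  rewrite big1 ?mulr_ge0 ?powR_ge0// => i Pi.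
  by rewrite (powR_sum_eq0 u0 A0 Pi) powR0// mul0r.
have [B0|BN0] := eqVneq B 0.
  rewrite big1 ?mulr_ge0 ?powR_ge0// => i Pi.
  by rewrite (powR_sum_eq0 v0 B0 Pi) powR0// mulr0.
have Ap : 0 < A by rewrite lt0r AN0 sumr_ge0.
have Bp : 0 < B by rewrite lt0r BN0 sumr_ge0.
have -> : \sum_(i | P i) u i `^ t * v i `^ (1 - t) =
   A `^ t * B `^ (1 - t) *
   \sum_(i | P i) (u i / A) `^ t * (v i / B) `^ (1 - t).
  rewrite big_distrr/=; apply: eq_bigr => i _.
  rewrite mulrACA -!powRM ?divr_ge0 ?(ltW Ap) ?(ltW Bp)//.
  by rewrite !(mulrC _ (_ / _)) !divfK.
rewrite ler_piMr ?mulr_ge0 ?powR_ge0//.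
apply: (@le_trans _ _ (\sum_(i | P i) (t * (u i / A) + (1 - t) * (v i / B)))).
  by apply: ler_sum => i _; apply: young_powR; rewrite ?divr_ge0 ?(ltW Ap) ?(ltW Bp).
rewrite big_split/= -!big_distrr/= -!big_distrl/= !divff// !mulr1.
by rewrite addrCA subrr addr0.
Qed.

Lemma cauchy_schwarz_sum (I : finType) (u v : I -> R) :
  (forall i, 0 <= u i) -> (forall i, 0 <= v i) ->
  \sum_i u i * v i <= Num.sqrt (\sum_i u i ^+ 2) * Num.sqrt (\sum_i v i ^+ 2).
Proof.
move=> u0 v0; have t01 : 0 <= (2^-1 : R) <= 1 by lra.
have := @hoelder_sum I xpredT (fun i => u i ^+ 2) (fun i => v i ^+ 2)
  _ t01 (fun i => exprn_ge0 2 (u0 i)) (fun i => exprn_ge0 2 (v0 i)).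
have -> : 1 - 2^-1 = 2^-1 :> R by lra.
rewrite !powR12_sqrt ?sumr_ge0// => [h|i _|i _]; rewrite ?exprn_ge0//.
apply: le_trans h; apply: ler_sum => i _.
by rewrite !powR12_sqrt ?exprn_ge0// !sqrtr_sqr !ger0_norm.
Qed.

Lemma power_mean (I : finType) (w y : I -> R) q :
  1 <= q -> (forall i, 0 <= w i) -> \sum_i w i = 1 -> (forall i, 0 <= y i) ->
  (\sum_i w i * y i) `^ q <= \sum_i w i * y i `^ q.
Proof.
move=> q1 w0 w1 y0; have q0 : 0 < q by apply: lt_le_trans q1.
have S0 : 0 <= \sum_i w i * y i `^ q.
  by apply: sumr_ge0 => i _; rewrite mulr_ge0// powR_ge0.
have : \sum_i w i * y i <= (\sum_i w i * y i `^ q) `^ q^-1.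
  have := @hoelder_sum I xpredT (fun i => w i * y i `^ q) w q^-1.
  rewrite invr_ge0 (ltW q0) invf_le1// q1 w1 powR1 mulr1 => /(_ isT).
  move=> /(_ (fun i => mulr_ge0 (w0 i) (powR_ge0 _ _)) w0); apply: le_trans.
  apply: ler_sum => i _; rewrite powRM ?powR_ge0// -powRrM mulfV ?gt_eqF//.
  rewrite powRr1// mulrAC -powRD; first by rewrite addrCA subrr addr0 powRr1.
  by rewrite addrCA subrr addr0 oner_eq0.
move=> /(ge0_ler_powR (ltW q0)); rewrite -powRrM mulVf ?gt_eqF// powRr1//.
by apply; rewrite nnegrE ?powR_ge0// sumr_ge0// => i _; rewrite mulr_ge0.
Qed.

Lemma sum_powR_le (I : finType) (P : pred I) (y : I -> R) q :
  1 <= q -> (forall i, 0 <= y i) ->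
  \sum_(i | P i) y i `^ q <= (\sum_(i | P i) y i) `^ q.
Proof.
move=> q1 y0; have q0 : 0 < q by apply: lt_le_trans q1.
set S := \sum_(i | P i) y i.
have S0 : 0 <= S by apply: sumr_ge0.
rewrite -(mulr_powRB1 S0 q0) big_distrl/=; apply: ler_sum => i Pi.
rewrite -mulr_powRB1// ler_wpM2l// ge0_ler_powR ?nnegrE ?subr_ge0//.
by rewrite /S (bigD1 i)//= lerDl sumr_ge0.
Qed.

(** The extremal [y] in Hoelder's inequality is the normalised power [w^(s/p)]. *)
Lemma lp_duality (I : finType) (w : I -> R) p q s :
  0 < p -> 0 < q -> 0 < s -> s^-1 = q^-1 - p^-1 -> (forall i, 0 <= w i) ->
  (forall y : I -> R, (forall i, 0 <= y i) -> \sum_i y i `^ p <= 1 ->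
     \sum_i y i `^ q * w i `^ q <= 1) ->
  \sum_i w i `^ s <= 1.
Proof.
move=> p0 q0 s0 spq w0 H; set S := \sum_i w i `^ s.
have S0 : 0 <= S by apply: sumr_ge0 => i _; exact: powR_ge0.
have [S0'|SN0] := eqVneq S 0; first by rewrite S0'.
have Sp : 0 < S by rewrite lt0r SN0.
have := H (fun i => w i `^ (s / p) * S `^ (- p^-1)).
have pN0 : p != 0 by rewrite gt_eqF.
have qN0 : q != 0 by rewrite gt_eqF.
have sN0 : s != 0 by rewrite gt_eqF.
have -> : \sum_i (w i `^ (s / p) * S `^ (- p^-1)) `^ p = 1.
  transitivity (\sum_i w i `^ s * S^-1); last by rewrite -big_distrl/= divff.
  apply: eq_bigr => i _; rewrite powRM ?powR_ge0// -!powRrM divfK//.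
  by rewrite mulNr mulVf// powR_inv1.
move=> /(_ (fun i => mulr_ge0 (powR_ge0 _ _) (powR_ge0 _ _)) (lexx _)).
have -> : \sum_i (w i `^ (s / p) * S `^ (- p^-1)) `^ q * w i `^ q = S `^ (q / s).
  transitivity (\sum_i w i `^ s * S `^ (- (q / p))).
    apply: eq_bigr => i _; rewrite powRM ?powR_ge0// -!powRrM mulrAC.
    rewrite -(@powRD _ (w i)).
      rewrite mulNr [_^-1 * q]mulrC; congr (_ `^ _ * _).
      transitivity (s * q * (p^-1 + s^-1)); first by field; apply/andP.
      by rewrite spq; field; apply/andP.
    apply/implyP => /eqP e; exfalso; move: e; apply/eqP; rewrite gt_eqF//.
    by rewrite addr_gt0// mulr_gt0// divr_gt0.
  rewrite -big_distrl/= -/S -{1}(powRr1 S0) -(@powRD _ S); last by rewrite SN0 implybT.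
  by congr (_ `^ _); rewrite spq; field; apply/andP.
move=> h; rewrite leNgt; apply/negP => S1.
move: h; rewrite leNgt => /negP; apply.
have : 1 `^ (q / s) < S `^ (q / s); last by rewrite powR1.
by rewrite gt0_ltr_powR ?nnegrE ?ler01 ?divr_gt0.
Qed.

Lemma lp_duality_scaled (I : finType) (w : I -> R) p q s M :
  0 < p -> 0 < q -> 0 < s -> s^-1 = q^-1 - p^-1 -> 0 < M ->
  (forall i, 0 <= w i) ->
  (forall y : I -> R, (forall i, 0 <= y i) -> \sum_i y i `^ p <= 1 ->
     \sum_i y i `^ q * w i `^ q <= M `^ q) ->
  \sum_i w i `^ s <= M `^ s.
Proof.
move=> p0 q0 s0 spq M0 w0 H.
have divM r i : (w i / M) `^ r = w i `^ r / M `^ r.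
  by rewrite powRM ?invr_ge0 ?(ltW M0)// -(@powR_inv1 _ M) ?(ltW M0)// -powRrM mulN1r powRN.
have H' : \sum_i (w i / M) `^ s <= 1.
  apply: (lp_duality p0 q0 s0 spq); first by move=> i; rewrite divr_ge0// ltW.
  move=> y y0 y1; have := H y y0 y1; rewrite -[leRHS]mul1r -ler_pdivrMr ?powR_gt0//.
  by rewrite big_distrl/=; under eq_bigr do rewrite -mulrA -divM.
move: H'; under eq_bigr do rewrite divM.
by rewrite -big_distrl/= ler_pdivrMr ?powR_gt0// mul1r.
Qed.

Lemma powRD_addK x p q : 0 <= x -> p + q = 1 -> x `^ p * x `^ q = x.
Proof. by move=> x0 pq; rewrite -(@powRD _ x) pq ?oner_eq0// powRr1. Qed.

Lemma powR_mulNr_le1 x p : x `^ p * x `^ (- p) <= 1.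
Proof.
have [->|p0] := eqVneq p 0; first by rewrite oppr0 powRr0 mulr1.
have [->|x0] := eqVneq x 0; first by rewrite powR0// mul0r.
by rewrite -(@powRD _ x) ?x0 ?implybT// subrr powRr0.
Qed.

(** The interpolation step of Hardy and Littlewood, for a matrix [G] with row sums
    [r i] and column sums [c j].  Weighting the columns is allowed in the first
    hypothesis, so duality applies to [W j = sum_i G i j * r_i^(l/2-1)]: the power
    of [r_i] is exactly what Hoelder's inequality inside a row loses.  Splitting
    [G i j * r_i^(s/2-1)] between [W j] and [c j] recovers [sum_i r_i^(s/2)]. *)
Lemma hardy_littlewood_transfer (I J : finType) (G : I -> J -> R) p l s :
  0 < p -> 0 < l -> l < s -> s < 2 -> s^-1 = l^-1 - p^-1 ->
  (forall i j, 0 <= G i j) ->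
  (forall y : J -> R, (forall j, 0 <= y j) -> \sum_j y j `^ p <= 1 ->
     \sum_i (\sum_j G i j * y j ^+ 2) `^ (l / 2) <= 1) ->
  \sum_j (\sum_i G i j) `^ (s / 2) <= 1 ->
  \sum_i (\sum_j G i j) `^ (s / 2) <= 1.
Proof.
move=> p0 l0 ls s2 sE G0 H1 H2.
have s0 : 0 < s by apply: lt_trans ls.
have l2 : l < 2 by apply: lt_trans s2.
pose r i := \sum_j G i j; pose c j := \sum_i G i j.
have r0 i : 0 <= r i by apply: sumr_ge0.
have c0 j : 0 <= c j by apply: sumr_ge0.
pose W j := \sum_i G i j * r i `^ (l / 2 - 1).
have W0 j : 0 <= W j by apply: sumr_ge0 => i _; rewrite mulr_ge0 ?powR_ge0.
have HW : \sum_j W j `^ (s / l) <= 1.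
  suff : \sum_j (W j `^ l^-1) `^ s <= 1.
    by under eq_bigr do rewrite -powRrM [_^-1 * _]mulrC.
  apply: (lp_duality p0 l0 s0 sE) => [j|y y0 y1]; first exact: powR_ge0.
  under eq_bigr do rewrite -powRrM mulVf ?gt_eqF// powRr1// big_distrr/=.
  rewrite exchange_big/=; apply: le_trans (H1 y y0 y1); apply: ler_sum => i _.
  under eq_bigr do rewrite mulrCA mulrA.
  rewrite -big_distrl/=.
  have t01 : 0 <= l / 2 <= 1 by lra.
  have h : \sum_j G i j * y j `^ l <=
      (\sum_j G i j * y j ^+ 2) `^ (l / 2) * r i `^ (1 - l / 2).
    apply: le_trans (@hoelder_sum J xpredT (fun j => G i j * y j ^+ 2) (G i) _ t01
      (fun j => mulr_ge0 (G0 i j) (exprn_ge0 2 (y0 j))) (G0 i)).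
    apply: ler_sum => j _; rewrite powRM ?exprn_ge0// -powR_mulrn// -powRrM.
    rewrite mulrAC powRD_addK; [by rewrite [2 * _]mulrC divfK|exact: G0|lra].
  apply: (le_trans (ler_wpM2r (powR_ge0 _ _) h)).
  rewrite -mulrA -[1 - _]opprB [X in _ * X]mulrC ler_piMr ?powR_ge0//.
  exact: powR_mulNr_le1.
(* The exponent for which [r_i^((l/2-1) t) = r_i^(s/2-1)]. *)
pose t := (2 - s) / (2 - l).
have t01 : 0 <= t <= 1.
  rewrite /t ler_pdivrMr ?divr_ge0 ?subr_ge0 ?mul1r ?lerD2l ?lerN2 ?subr_gt0//;
    by rewrite ?(ltW ls) ?(ltW s2) ?(ltW l2).
have d2 : 2 - l != 0 by rewrite gt_eqF// subr_gt0.
have lN0 : l != 0 by rewrite gt_eqF.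
have sN0 : s != 0 by rewrite gt_eqF.
have tE : (l / 2 - 1) * t = s / 2 - 1 by rewrite /t; field.
have s1E : s / 2 = 1 + (s / 2 - 1) by ring.
have step i : r i `^ (s / 2) = \sum_j G i j * r i `^ (s / 2 - 1).
  rewrite -big_distrl/= -/(r i).
  have [r00|rN0] := eqVneq (r i) 0; first by rewrite r00 mul0r powR0// gt_eqF// divr_gt0.
  by rewrite [in LHS]s1E (@powRD _ (r i)) ?rN0 ?implybT// powRr1.
rewrite (eq_bigr _ (fun i _ => step i)) exchange_big/=.
have le1 j : \sum_i G i j * r i `^ (s / 2 - 1) <= W j `^ t * c j `^ (1 - t).
  have := @hoelder_sum I xpredT (fun i => G i j * r i `^ (l / 2 - 1)) (fun i => G i j) _ t01
    (fun i => mulr_ge0 (G0 i j) (powR_ge0 _ _)) (fun i => G0 i j).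
  apply: le_trans; apply: ler_sum => i _.
  rewrite powRM ?powR_ge0// -powRrM tE mulrAC powRD_addK//; lra.
apply: (le_trans (ler_sum _ (fun j _ => le1 j))).
(* Chosen so that [t = (s/l) a] and [1 - t = (s/2)(1 - a)], whence the two known sums. *)
pose a := t * (l / s).
have aE : 1 - a = (1 - t) / (s / 2) by rewrite /a /t; field; rewrite ?sN0 ?lN0 ?d2.
have a01 : 0 <= a <= 1.
  have /andP[t0 t1] := t01; apply/andP; split.
    by rewrite mulr_ge0// divr_ge0 ?ltW.
  by rewrite -subr_ge0 aE !divr_ge0 ?subr_ge0// ltW.
apply: (@le_trans _ _ ((\sum_j W j `^ (s / l)) `^ a *
    (\sum_j c j `^ (s / 2)) `^ (1 - a))).
  apply: le_trans (@hoelder_sum J xpredT (fun j => W j `^ (s / l))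
    (fun j => c j `^ (s / 2)) _ a01 (fun j => powR_ge0 _ _) (fun j => powR_ge0 _ _)).
  apply: ler_sum => j _; rewrite -!powRrM aE le_eqVlt; apply/orP; left; apply/eqP.
  by congr (_ `^ _ * _ `^ _); rewrite /a; field; rewrite ?sN0 ?lN0.
have /andP[a0 a1] := a01.
rewrite mulr_ile1 ?powR_ge0//.
- rewrite -[leRHS](_ : 1 `^ a = 1); last by rewrite powR1.
  by rewrite ge0_ler_powR ?nnegrE ?ler01//; apply: sumr_ge0 => j _; exact: powR_ge0.
- rewrite -[leRHS](_ : 1 `^ (1 - a) = 1); last by rewrite powR1.
  by rewrite ge0_ler_powR ?nnegrE ?ler01 ?subr_ge0//; apply: sumr_ge0 => j _; exact: powR_ge0.
Qed.

(** The product of [r] functions of the unit ball of [l_m] lies in the unit ball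
    of [l_(m/r)].  The auxiliary [w] absorbs one factor at a time in the
    induction. *)
Lemma sum_prod_ball (I : finType) (m : nat) (cs : seq (I -> R)) :
  (forall c, List.In c cs -> forall i, 0 <= c i) ->
  (forall c, List.In c cs -> \sum_i c i `^ m%:R <= 1) ->
  forall w : I -> R, (size cs <= m)%N -> (forall i, 0 <= w i) ->
  \sum_i (\prod_(c <- cs) c i) * w i `^ (1 - (size cs)%:R / m%:R) <=
  (\sum_i w i) `^ (1 - (size cs)%:R / m%:R).
Proof.
elim: cs => [|c cs IH] H0 H1 w szm w0.
  rewrite mul0r subr0 powRr1 ?sumr_ge0//.
  by under eq_bigr do rewrite big_nil mul1r powRr1//.
have m0 : 0 < m%:R :> R by rewrite ltr0n (leq_trans _ szm).
set r := size cs in IH *; rewrite /= -/r in szm *.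
have mr0 : 0 < m%:R - r%:R :> R by rewrite subr_gt0 ltr_nat.
have mN0 : m%:R != 0 :> R by rewrite gt_eqF.
have mrN0 : m%:R - r%:R != 0 :> R by rewrite gt_eqF.
pose t : R := (m%:R - r%:R)^-1.
have t01 : 0 <= t <= 1.
  rewrite /t invr_ge0 (ltW mr0) invf_le1// -natrB ?(ltnW szm)//.
  by rewrite ler1n subn_gt0.
have c0 i : 0 <= c i by apply: H0; left.
pose w' i := (c i `^ m%:R) `^ t * w i `^ (1 - t).
have w'0 i : 0 <= w' i by rewrite mulr_ge0 ?powR_ge0.
have := IH (fun d dcs => H0 d (or_intror dcs)) (fun d dcs => H1 d (or_intror dcs))
  w' (ltnW szm) w'0.
have e1 : t * (1 - r%:R / m%:R) = m%:R^-1 by rewrite /t; field; apply/andP.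
have e2 : (1 - t) * (1 - r%:R / m%:R) = 1 - r.+1%:R / m%:R.
  by rewrite /t -natr1; field; apply/andP.
have r0 : 0 <= 1 - r%:R / m%:R :> R.
  by rewrite subr_ge0 ler_pdivrMr// mul1r ler_nat ltnW.
move=> h; apply: (@le_trans _ _ ((\sum_i w' i) `^ (1 - r%:R / m%:R))).
  apply: le_trans h; rewrite le_eqVlt; apply/orP; left; apply/eqP.
  apply: eq_bigr => i _; rewrite big_cons /w' powRM ?powR_ge0// -!powRrM.
  rewrite -mulrA e1 mulfV// powRr1// e2; ring.
rewrite -e2 [X in _ <= X]powRrM ge0_ler_powR ?nnegrE ?powR_ge0 ?sumr_ge0//.
have tt : 0 <= 1 - t by lra.
apply: le_trans (@hoelder_sum I xpredT _ w t t01 (fun i => powR_ge0 (c i) m%:R) w0) _.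
rewrite ler_piMl ?powR_ge0// -[leRHS](_ : 1 `^ t = 1); last by rewrite powR1.
have /andP[tg0 _] := t01.
rewrite ge0_ler_powR ?nnegrE ?ler01//; first by apply: sumr_ge0 => i _; exact: powR_ge0.
by apply: H1; left.
Qed.

End Inequalities.

(** * Scalars with a modulus, and Khinchine's inequality *)

(** What the argument uses of the real and complex absolute values; the
    parallelogram identity is the only Hilbertian ingredient, so that no scalar
    product has to be introduced. *)
Record is_modulus (R : realType) (K : fieldType) (abs : K -> R)
    (iota : {rmorphism R -> K}) : Prop := IsModulus {
  absM : forall a b, abs (a * b) = abs a * abs b;
  absD : forall a b, abs (a + b) <= abs a + abs b;
  abs_ge0 : forall a, 0 <= abs a;
  abs_iota : forall r, abs (iota r) = `|r|;
  abs_parallelogram : forall a b,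
    abs (a + b) ^+ 2 + abs (a - b) ^+ 2 = 2 * (abs a ^+ 2 + abs b ^+ 2)
}.

Lemma modulus_real (R : realType) : is_modulus (@modulus R Reals) idfun.
Proof.
split=> //=; [exact: normrM|exact: ler_normD|move=> a b].
by rewrite !real_normK ?num_real//; ring.
Qed.

Lemma modulus_complex (R : realType) :
  is_modulus (@modulus R Complexes) (real_complex R).
Proof.
have e (z : complex R) : @modulus R Complexes z = Num.sqrt (complex.Re z ^+ 2 + complex.Im z ^+ 2).
  by case: z.
have h (z : complex R) : (@modulus R Complexes z)%:C%C = `|z|.
  by rewrite e; case: z.
split=> [a b|a b|a|r|a b].
- by apply: complexI; rewrite rmorphM !h; exact: normrM.
- by rewrite -lecR rmorphD !h; exact: ler_normD.
- by rewrite e sqrtr_ge0.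
- by rewrite e /= expr0n/= addr0 sqrtr_sqr.
- rewrite !e !sqr_sqrtr ?addr_ge0 ?sqr_ge0//; case: a b => [a1 a2] [b1 b2] /=; ring.
Qed.

Section Modulus.
Variables (R : realType) (K : fieldType) (abs : K -> R) (iota : {rmorphism R -> K}).
Hypothesis absP : is_modulus abs iota.
Let absM := absM absP.
Let absD := absD absP.
Let abs_ge0 := abs_ge0 absP.
Let abs_iota := abs_iota absP.

Lemma abs0 : abs 0 = 0. Proof. by rewrite -(rmorph0 iota) abs_iota normr0. Qed.
Lemma abs1 : abs 1 = 1. Proof. by rewrite -(rmorph1 iota) abs_iota normr1. Qed.

Lemma abs_sign (b : bool) : abs ((-1) ^+ b) = 1.
Proof.
by case: b; rewrite ?expr1 ?abs1// -(rmorph1 iota) -rmorphN abs_iota normrN normr1.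
Qed.

Lemma abs_bool (b : bool) : abs b%:R = b%:R.
Proof. by case: b; rewrite ?abs0 ?abs1. Qed.

Lemma absN a : abs (- a) = abs a.
Proof. by rewrite -mulN1r absM (abs_sign true) mul1r. Qed.

Lemma abs_eq0 a : (abs a == 0) = (a == 0).
Proof.
have [->|a0] := eqVneq a 0; first by rewrite abs0 eqxx.
apply/negbTE/eqP => aa; have := absM a a^-1; rewrite mulfV// abs1 aa mul0r.
by move/eqP; rewrite oner_eq0.
Qed.

Lemma abs_sum (I : Type) (s : seq I) (P : pred I) (F : I -> K) :
  abs (\sum_(i <- s | P i) F i) <= \sum_(i <- s | P i) abs (F i).
Proof.
elim/big_ind2: _ => [|a b c d ab cd|//]; first by rewrite abs0.
by apply: (le_trans (absD _ _)); rewrite lerD.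
Qed.

Lemma abs_prod (I : Type) (s : seq I) (P : pred I) (F : I -> K) :
  abs (\prod_(i <- s | P i) F i) = \prod_(i <- s | P i) abs (F i).
Proof. exact: (big_morph abs absM abs1). Qed.

Lemma abs_phase a : exists2 u, abs u = 1 & u * a = iota (abs a).
Proof.
have [->|a0] := eqVneq a 0; first by exists 1; rewrite ?abs1// mulr0 abs0 rmorph0.
have aa0 : abs a != 0 by rewrite abs_eq0.
exists (iota (abs a) / a); last by rewrite divfK.
apply: (mulIf aa0); rewrite -absM divfK// abs_iota mul1r.
by rewrite ger0_norm.
Qed.

(** The left-hand side is four times the real part of a scalar product, so this is
    Cauchy-Schwarz in dimension one, obtained here from the triangle
    inequality. *)
Lemma abs_sub_sqr (y a : K) :
  `|abs (y + a) ^+ 2 - abs (y - a) ^+ 2| <= 4 * (abs y * abs a).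
Proof.
have h (c d : K) : abs (c + d) ^+ 2 - abs (c - d) ^+ 2 <= 4 * (abs c * abs d).
  have h1 : abs (c + d) <= abs c + abs d by [].
  have h2 : abs c <= abs (c - d) + abs d by rewrite -{1}(subrK d c).
  have h3 : abs d <= abs (c - d) + abs c.
    by rewrite -(absN (c - d)) opprB -{1}(subrK c d).
  have := abs_ge0 c; have := abs_ge0 d; have := abs_ge0 (c - d).
  have := abs_ge0 (c + d).
  move: (abs (c + d)) (abs (c - d)) (abs c) (abs d) h1 h2 h3 => P Q u v.
  move=> *.
  have : P ^+ 2 <= (u + v) ^+ 2 by rewrite lerXn2r// nnegrE addr_ge0.
  have : (u - v) ^+ 2 <= Q ^+ 2.
    have q1 : 0 <= Q - (u - v) by lra.
    have q2 : 0 <= Q + (u - v) by lra.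
    by have := mulr_ge0 q1 q2; nra.
  nra.
rewrite ler_norml h andbT lerNl opprB.
by have := h y (- a); rewrite opprK absN.
Qed.

Definition vsq (T : finType) (v : T -> K) : R := \sum_t abs (v t) ^+ 2.

Lemma vsq_ge0 (T : finType) (v : T -> K) : 0 <= vsq v.
Proof. by apply: sumr_ge0 => t _; rewrite exprn_ge0. Qed.

(** The two-point case of the comparison of the fourth and second moments of
    Rademacher sums; the constant 12 is what makes the bound by three times the
    square of the variance stable under the addition of a term. *)
Lemma vsq_two_points (T : finType) (y a : T -> K) :
  let P := vsq (fun t => y t + a t) in let Q := vsq (fun t => y t - a t) in
  P + Q = 2 * (vsq y + vsq a) /\
  P ^+ 2 + Q ^+ 2 <= 2 * vsq y ^+ 2 + 12 * vsq y * vsq a + 2 * vsq a ^+ 2.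
Proof.
move=> P Q.
have PQ : P + Q = 2 * (vsq y + vsq a).
  rewrite -!big_split/= big_distrr/=; apply: eq_bigr => t _.
  exact: (abs_parallelogram absP).
split=> //.
have dPQ : `|P - Q| <= 4 * \sum_t abs (y t) * abs (a t).
  rewrite -sumrB big_distrr/=; apply: (le_trans (ler_norm_sum _ _ _)).
  by apply: ler_sum => t _; exact: abs_sub_sqr.
have cs : (\sum_t abs (y t) * abs (a t)) ^+ 2 <= vsq y * vsq a.
  have h := cauchy_schwarz_sum (fun t => abs_ge0 (y t)) (fun t => abs_ge0 (a t)).
  rewrite -[vsq y]sqr_sqrtr ?vsq_ge0// -[vsq a]sqr_sqrtr ?vsq_ge0// -exprMn.
  rewrite lerXn2r ?nnegrE// ?mulr_ge0 ?sqrtr_ge0//.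
  by apply: sumr_ge0 => t _; rewrite mulr_ge0.
have : (P - Q) ^+ 2 <= 16 * (vsq y * vsq a).
  rewrite -real_normK ?num_real//.
  have -> : 16 * (vsq y * vsq a) = 4 ^+ 2 * (vsq y * vsq a) by ring.
  apply: le_trans (ler_wpM2l _ cs); rewrite ?exprn_ge0// -exprMn.
  by rewrite lerXn2r ?nnegrE// (le_trans (normr_ge0 _) dPQ).
have := vsq_ge0 y; have := vsq_ge0 a; have := @vsq_ge0 T (fun t => y t + a t).
have := @vsq_ge0 T (fun t => y t - a t); rewrite -/P -/Q.
move: PQ => /(congr1 (fun x => x ^+ 2)); nra.
Qed.

Section Rademacher.
Variables (J T : finType) (a : J -> T -> K).
Implicit Types (e : {ffun J -> bool}) (s : seq J).

Definition rademacher e s t : K := \sum_(j <- s) (-1) ^+ e j * a j t.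

Definition flip j e : {ffun J -> bool} := [ffun k => (k == j) (+) e k].

Lemma flipK j : involutive (flip j).
Proof. by move=> e; apply/ffunP => k; rewrite !ffunE addbA addbb. Qed.

Lemma sum_flip j (F : {ffun J -> bool} -> R) :
  \sum_e F e = 2^-1 * \sum_e (F e + F (flip j e)).
Proof.
have E : \sum_e F (flip j e) = \sum_e F e.
  by rewrite [RHS](reindex_inj (inv_inj (flipK j))).
by rewrite big_split/= E; field.
Qed.

Let m2 e s := vsq (rademacher e s).
Let V s := \sum_(j <- s) vsq (a j).

Lemma rademacher_flip_notin j e s t : j \notin s ->
  rademacher (flip j e) s t = rademacher e s t.
Proof.
move=> js; apply: eq_big_seq => k ks; rewrite ffunE.
by case: eqP => // kj; rewrite -kj ks in js.
Qed.

Lemma m2_flip j e s : j \notin s ->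
  m2 e (j :: s) + m2 (flip j e) (j :: s) = 2 * (m2 e s + vsq (a j)) /\
  m2 e (j :: s) ^+ 2 + m2 (flip j e) (j :: s) ^+ 2 <=
    2 * m2 e s ^+ 2 + 12 * m2 e s * vsq (a j) + 2 * vsq (a j) ^+ 2.
Proof.
move=> js; have [h1 h2] := vsq_two_points (rademacher e s) (a j).
have E e' : rademacher e' (j :: s) = fun t => rademacher e' s t + (-1) ^+ e' j * a j t.
  by apply/funext => t; rewrite /rademacher big_cons addrC.
have F : rademacher (flip j e) s = rademacher e s.
  by apply/funext => t; exact: rademacher_flip_notin.
have e0 : vsq (fun t => rademacher e s t + (-1) ^+ false * a j t) =
    vsq (fun t => rademacher e s t + a j t).
  by congr vsq; apply/funext => t; rewrite expr0 mul1r.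
have e1 : vsq (fun t => rademacher e s t + (-1) ^+ true * a j t) =
    vsq (fun t => rademacher e s t - a j t).
  by congr vsq; apply/funext => t; rewrite expr1 mulN1r.
rewrite /m2 !E F ffunE eqxx addTb; case: (e j); rewrite e0 e1; last by split.
by rewrite addrC [X in _ /\ X <= _]addrC; split.
Qed.

Let N : R := #|{ffun J -> bool}|%:R.

(** Induction on the set of indices: flipping the sign of the new index pairs the
    sign patterns, and each pair is an instance of the two-point case. *)
Lemma rademacher_moments s : uniq s ->
  \sum_e m2 e s = N * V s /\ \sum_e m2 e s ^+ 2 <= 3 * N * V s ^+ 2.
Proof.
elim: s => [_|j s IH /= /andP[js /IH[h1 h2]]].
  have m0 e : m2 e [::] = 0.
    by apply: big1 => t _; rewrite /rademacher big_nil abs0 expr0n.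
  rewrite /V big_nil !mulr0 expr0n/= mulr0.
  by split; [|rewrite le_eqVlt; apply/orP; left; apply/eqP]; apply: big1 => e _; rewrite m0 ?expr0n.
have N0 : 0 <= N by apply: ler0n.
have Vj : V (j :: s) = vsq (a j) + V s by rewrite /V big_cons.
rewrite Vj; split.
  rewrite (sum_flip j) (eq_bigr _ (fun e _ => (m2_flip e js).1)) -big_distrr/=.
  rewrite mulKf ?pnatr_eq0// big_split/= h1 sumr_const -(mulr_natl _ #|_|) -/N; ring.
rewrite (sum_flip j).
apply: (@le_trans _ _ (2^-1 *
    \sum_e (2 * m2 e s ^+ 2 + 12 * m2 e s * vsq (a j) + 2 * vsq (a j) ^+ 2))).
  by rewrite ler_wpM2l ?invr_ge0 ?ler0n//; apply: ler_sum => e _; exact: (m2_flip e js).2.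
rewrite !big_split/= -big_distrl/= -!big_distrr/= h1 sumr_const -(mulr_natl _ #|_|) -/N.
have := vsq_ge0 (a j); have : 0 <= V s by apply: sumr_ge0 => i _; exact: vsq_ge0.
move: h2; set X := \sum_e _; move: (V s) (vsq (a j)) => v w h2 v0 w0.
have : 0 <= N * w ^+ 2 by rewrite mulr_ge0// exprn_ge0.
have : 0 <= N * v * w by rewrite !mulr_ge0.
lra.
Qed.

(** With variance [v], the fourth moment is at most [3 v^2], and the pointwise bound
    [sqrt v * sqrt x >= x - x^2/(4 v)] can be averaged. *)
Lemma khinchine :
  Num.sqrt (\sum_j vsq (a j)) * N <=
  4 * \sum_(e : {ffun J -> bool}) Num.sqrt (vsq (fun t => \sum_j (-1) ^+ e j * a j t)).
Proof.
have [h1 h2] := rademacher_moments (index_enum_uniq J).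
have N0 : 0 <= N by apply: ler0n.
have v0 : 0 <= \sum_j vsq (a j) by apply: sumr_ge0 => j _; exact: vsq_ge0.
move: h1 h2 v0; rewrite /V; move: (\sum_j vsq (a j)) => v h1 h2 v0.
have -> : \sum_(e : {ffun J -> bool}) Num.sqrt (vsq (fun t => \sum_j (-1) ^+ e j * a j t)) =
  \sum_e Num.sqrt (m2 e (index_enum J)) by [].
set S := \sum_e Num.sqrt _.
have S0 : 0 <= S by apply: sumr_ge0 => e _; rewrite sqrtr_ge0.
have [v00|vN0] := eqVneq v 0; first by rewrite v00 sqrtr0 mul0r mulr_ge0.
have vp : 0 < v by rewrite lt0r vN0.
have rp : 0 < Num.sqrt v by rewrite sqrtr_gt0.
have rv : Num.sqrt v ^+ 2 = v by rewrite sqr_sqrtr.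
have key (x : R) : 0 <= x -> x - x ^+ 2 / (4 * v) <= Num.sqrt v * Num.sqrt x.
  move=> x0; have : Num.sqrt x ^+ 2 = x by rewrite sqr_sqrtr.
  have : 0 <= Num.sqrt x by exact: sqrtr_ge0.
  move: (Num.sqrt v) (Num.sqrt x) rp rv => c d c0 <- d0 <-.
  rewrite -subr_ge0.
  have -> : c * d - (d ^+ 2 - (d ^+ 2) ^+ 2 / (4 * c ^+ 2)) =
     (d / (4 * c ^+ 2)) * (d ^+ 3 - 4 * c ^+ 2 * d + 4 * c ^+ 3).
    by field; rewrite gt_eqF.
  rewrite mulr_ge0//; first by rewrite divr_ge0// mulr_ge0// exprn_ge0// ltW.
  have [dc|cd] := leP d c; last first.
    have : 0 <= d * (d - 2 * c) ^+ 2 by rewrite mulr_ge0// sqr_ge0.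
    have : 0 <= c ^+ 2 * (d - c) by rewrite mulr_ge0 ?exprn_ge0 ?subr_ge0 ?ltW.
    have : 0 <= c * (d - c) ^+ 2 by rewrite mulr_ge0 ?sqr_ge0 ?ltW.
    have : 0 <= c * d ^+ 2 by rewrite mulr_ge0 ?sqr_ge0 ?ltW.
    have : 0 <= c ^+ 3 by rewrite exprn_ge0 ?ltW.
    nra.
  have : 0 <= c ^+ 2 * (c - d) by apply: mulr_ge0; rewrite ?exprn_ge0 ?subr_ge0 ?(ltW c0).
  have : 0 <= d ^+ 3 by rewrite exprn_ge0.
  nra.
have : \sum_e (m2 e (index_enum J) - m2 e (index_enum J) ^+ 2 / (4 * v)) <= Num.sqrt v * S.
  rewrite /S big_distrr/=; apply: ler_sum => e _; apply: key; exact: vsq_ge0.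
rewrite sumrB -big_distrl/= h1 => h.
have : (\sum_e m2 e (index_enum J) ^+ 2) / (4 * v) <= (3 * N * v ^+ 2) / (4 * v).
  by rewrite ler_wpM2r// invr_ge0 mulr_ge0.
have -> : 3 * N * v ^+ 2 / (4 * v) = 3 / 4 * N * v by field.
move=> h3; rewrite -(ler_pM2l rp).
have : Num.sqrt v * (Num.sqrt v * N) = v * N by rewrite mulrA -expr2 rv.
lra.
Qed.
End Rademacher.
End Modulus.

(** * Multilinear forms and the mixed (l_1, l_2) Littlewood inequality *)

Section Forms.
Variables (R : realType) (K : fieldType) (abs : K -> R) (iota : {rmorphism R -> K}).
Hypothesis absP : is_modulus abs iota.
Let absM := absM absP.
Let abs_ge0 := abs_ge0 absP.
Let abs_iota := abs_iota absP.

Definition upd (T : eqType) (V : Type) (z : T -> V) (i : T) (v : V) : T -> V :=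
  fun k => if k == i then v else z k.

Lemma upd_id (T : eqType) (V : Type) (z : T -> V) i : upd z i (z i) = z.
Proof. by apply/funext => k; rewrite /upd; case: eqP => [->|]. Qed.

Lemma upd_upd (T : eqType) (V : Type) (z : T -> V) i u v :
  upd (upd z i u) i v = upd z i v.
Proof. by apply/funext => k; rewrite /upd; case: eqP. Qed.

Lemma updC (T : eqType) (V : Type) (z : T -> V) i j u v : i != j ->
  upd (upd z i u) j v = upd (upd z j v) i u.
Proof.
move=> ij; apply/funext => k; rewrite /upd.
by case: (k =P j) => // ->; rewrite eq_sym (negbTE ij).
Qed.

Section OneForm.
Variables (d n : nat).
Local Notation form := (('I_d -> 'rV[K]_n) -> K).
Implicit Types (A : form) (z : 'I_d -> 'rV[K]_n) (f : {ffun 'I_d -> 'I_n}).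

Lemma ml_lin A : multilinear_form A -> forall z i c u v,
  A (upd z i (c *: u + v)) = c * A (upd z i u) + A (upd z i v).
Proof. by move=> mA z i c u v; exact: mA. Qed.

Lemma ml_intro A : (forall z i c u v,
  A (upd z i (c *: u + v)) = c * A (upd z i u) + A (upd z i v)) -> multilinear_form A.
Proof. by move=> H i z c u v; exact: H. Qed.

Lemma ml_upd0 A z i : multilinear_form A -> A (upd z i 0) = 0.
Proof.
move=> mA; have := ml_lin mA z i (-1) 0 0.
by rewrite scaler0 addr0 mulN1r addNr.
Qed.

Lemma ml_updZ A z i c u : multilinear_form A -> A (upd z i (c *: u)) = c * A (upd z i u).
Proof. by move=> mA; rewrite -[c *: u]addr0 ml_lin// ml_upd0// addr0. Qed.

Lemma ml_upd_sum A z i (I : Type) (s : seq I) (c : I -> K) (w : I -> 'rV_n) :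
  multilinear_form A ->
  A (upd z i (\sum_(k <- s) c k *: w k)) = \sum_(k <- s) c k * A (upd z i (w k)).
Proof.
move=> mA; elim: s => [|k s IH]; first by rewrite !big_nil ml_upd0.
by rewrite !big_cons ml_lin// IH.
Qed.

Lemma ml_expand A z i v : multilinear_form A ->
  A (upd z i v) = \sum_j v 0 j * A (upd z i (delta_mx 0 j)).
Proof. by move=> mA; rewrite {1}[v]row_sum_delta ml_upd_sum. Qed.

Lemma ml_scale A z (c : 'I_d -> K) : multilinear_form A ->
  A (fun l => c l *: z l) = (\prod_l c l) * A z.
Proof.
move=> mA; have H (s : seq 'I_d) : uniq s ->
    A (fun l => if l \in s then c l *: z l else z l) = (\prod_(l <- s) c l) * A z.
  elim: s => [_|l s IH /= /andP[ls us]].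
    by rewrite big_nil mul1r; congr A; apply/funext.
  rewrite big_cons -mulrA -IH//.
  rewrite -[X in _ = _ * A X](upd_id _ l) (negbTE ls) -ml_updZ//.
  congr A; apply/funext => k; rewrite /upd inE.
  by case: eqP => // ->.
rewrite -(H _ (index_enum_uniq _)); congr A; apply/funext => l.
by rewrite mem_index_enum.
Qed.

Definition basis f : 'I_d -> 'rV[K]_n := fun l => delta_mx 0 (f l).

Definition fupd f l k : {ffun 'I_d -> 'I_n} := [ffun a => if a == l then k else f a].

Lemma basis_fupd f l k : basis (fupd f l k) = upd (basis f) l (delta_mx 0 k).
Proof. by apply/funext => a; rewrite /basis /upd ffunE; case: eqP. Qed.

(** Boundedness on products of unit balls of [l_oo], resp. of [l_p].  A bound [M] is
    kept as a parameter, which avoids any appeal to suprema until the end. *)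
Definition sup_bounded A (M : R) :=
  forall z, (forall l j, abs (z l 0 j) <= 1) -> abs (A z) <= M.

Definition ball_bounded (p : R) A (M : R) :=
  forall z, (forall l, \sum_j abs (z l 0 j) `^ p <= 1) -> abs (A z) <= M.

Lemma abs_delta (j k : 'I_n) : abs ((delta_mx 0 j : 'rV[K]_n) 0 k) = (k == j)%:R.
Proof. by rewrite mxE eqxx/= (abs_bool absP). Qed.

(** Expanding the variables one by one reduces to the finitely many values on the
    canonical basis; this is what makes the supremum defining the norm of a form
    finite. *)
Lemma ml_bounded A : multilinear_form A -> exists C, sup_bounded A C.
Proof.
move=> mA.
have H k : (k <= d)%N -> exists C : R, forall z,
    (forall l j, abs (z l 0 j) <= 1) ->
    (forall l : 'I_d, (k <= l)%N -> exists j, z l = delta_mx 0 j) -> abs (A z) <= C.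
  elim: k => [_|k IH kd].
    exists (\sum_f abs (A (basis f))) => z _ zb.
    pose f := [ffun l : 'I_d => sval (cid (zb l (leq0n l)))].
    have -> : z = basis f.
      by apply/funext => l; rewrite /basis ffunE; exact: (svalP (cid (zb l (leq0n l)))).
    by rewrite (bigD1 f)//= lerDl sumr_ge0.
  have [C HC] := IH (ltnW kd).
  have C0 : n = 0 \/ 0 <= C.
    case: (posnP n) => [->|n0]; [by left|right].
    apply: le_trans (abs_ge0 _) (HC (fun=> delta_mx 0 (Ordinal n0)) _ _) => l.
      by move=> j; rewrite abs_delta; case: eqP; rewrite ?lexx ?ler01.
    by move=> _; exists (Ordinal n0).
  exists (\sum_(j < n) C) => z z1 zb.
  pose l := Ordinal kd.
  rewrite -(upd_id z l) ml_expand//; apply: (le_trans (abs_sum absP _ _ _)).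
  apply: ler_sum => j _; rewrite absM -[leRHS]mul1r ler_pM//.
  apply: HC => l'.
    move=> j'; rewrite /upd; case: eqP => // _.
    by rewrite abs_delta; case: eqP; rewrite ?lexx ?ler01.
  rewrite /upd leq_eqVlt => /predU1P[kl|/zb]; last by case: eqP => // _; exists j.
  have -> : l' == l by apply/eqP/val_inj.
  by exists j.
have [C HC] := H d (leqnn d); exists C => z z1; apply: HC => // l.
by rewrite leqNgt ltn_ord.
Qed.

(** Evaluation of the variable [l] at the vector [v], presented as a form in the same
    variables which depends on the variable [l] only through its coordinate [j0].
    Keeping the arity fixed spares all reindexing when the variables other than [i]
    are evaluated one after the other. *)
Definition contract A l (j0 : 'I_n) (v : 'rV[K]_n) : form :=
  fun z => A (upd z l (z l 0 j0 *: v)).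

Lemma contract_ml A l j0 v : multilinear_form A -> multilinear_form (contract A l j0 v).
Proof.
move=> mA; apply: ml_intro => z i c u w; rewrite /contract.
have [->|il] := eqVneq i l.
  have E v' : upd z l v' l = v' by rewrite /upd eqxx.
  rewrite !upd_upd !E.
  by rewrite !mxE scalerDl -scalerA ml_lin// !ml_updZ.
have E v' : upd z i v' l = z l by rewrite /upd eq_sym (negbTE il).
by rewrite !E ![upd (upd z i _) l _]updC// ml_lin.
Qed.

Lemma contract_bounded A l j0 (v : 'rV[K]_n) M : sup_bounded A M ->
  (forall j, abs (v 0 j) <= 1) -> sup_bounded (contract A l j0 v) M.
Proof.
move=> bA v1 z z1; apply: bA => l' j; rewrite /upd; case: eqP => // _.
by rewrite mxE absM mulr_ile1.
Qed.

Lemma contract_basis A l j0 v f : multilinear_form A ->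
  contract A l j0 v (basis f) =
  if f l == j0 then \sum_k v 0 k * A (basis (fupd f l k)) else 0.
Proof.
move=> mA; rewrite /contract {2}/basis mxE eqxx/= eq_sym.
case: eqP => _; last by rewrite scale0r ml_upd0.
by rewrite scale1r ml_expand//; apply: eq_bigr => k _; rewrite basis_fupd.
Qed.

Lemma sum_fupd (F : {ffun 'I_d -> 'I_n} -> R) i l j j0 : l != i ->
  \sum_(f : {ffun 'I_d -> 'I_n} | f i == j) F f =
  \sum_k \sum_(f : {ffun 'I_d -> 'I_n} | (f i == j) && (f l == j0)) F (fupd f l k).
Proof.
move=> li; rewrite (partition_big (fun f : {ffun 'I_d -> 'I_n} => f l) xpredT)//=.
apply: eq_bigr => k _.
rewrite (reindex_onto (fun f => fupd f l k) (fun f => fupd f l j0))/=.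
  have il : (i == l) = false by rewrite eq_sym (negbTE li).
  apply: eq_bigl => f; rewrite !ffunE il eqxx eqxx andbT.
  congr andb; apply/eqP/eqP => [<-|fl]; first by rewrite ffunE eqxx.
  by apply/ffunP => a; rewrite !ffunE; case: eqP => // ->.
move=> f /andP[_ /eqP fl]; apply/ffunP => a; rewrite !ffunE.
by case: eqP => // ->.
Qed.

(** Littlewood's mixed (l_1, l_2) norm of the coefficients, with the variable [i] outside. *)
Definition mixed12 A (i : 'I_d) : R :=
  \sum_j Num.sqrt (\sum_(f : {ffun 'I_d -> 'I_n} | f i == j) abs (A (basis f)) ^+ 2).

(** Khinchine's inequality in the variable [l], applied for every value of the
    variable [i] to vectors indexed by the remaining variables. *)
Lemma mixed12_contract A i l j0 : multilinear_form A -> l != i ->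
  mixed12 A i * #|{ffun 'I_n -> bool}|%:R <=
  4 * \sum_(e : {ffun 'I_n -> bool}) mixed12 (contract A l j0 (\row_k (-1) ^+ e k)) i.
Proof.
move=> mA li; rewrite /mixed12 exchange_big/= big_distrl big_distrr/=.
apply: ler_sum => j _.
(* Restricting to [f l = j0] counts each choice of the variables other than [l] once. *)
pose a (k : 'I_n) f := if (f i == j) && (f l == j0) then A (basis (fupd f l k)) else 0.
have := khinchine absP a.
rewrite (_ : \sum_k vsq abs (a k) =
  \sum_(f : {ffun 'I_d -> 'I_n} | f i == j) abs (A (basis f)) ^+ 2); last first.
  rewrite (sum_fupd _ j j0 li); apply: eq_bigr => k _.
  rewrite [RHS]big_mkcond; apply: eq_bigr => f _.
  by rewrite /a; case: ifP => // _; rewrite (abs0 absP) expr0n.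
move=> /le_trans; apply; rewrite ler_wpM2l//; apply: ler_sum => e _.
rewrite le_eqVlt; apply/orP; left; apply/eqP; congr Num.sqrt.
rewrite [RHS]big_mkcond; apply: eq_bigr => f _.
rewrite contract_basis// /a; case: (f i == j) => /=; last first.
  by rewrite big1 ?(abs0 absP) ?expr0n// => k _; rewrite mulr0.
case: (f l == j0) => //=; last by rewrite big1// => k _; rewrite mulr0.
by congr (abs _ ^+ 2); apply: eq_bigr => k _; rewrite mxE.
Qed.

(** The phases of the coefficients form a vector of the unit ball of [l_oo]. *)
Lemma row_sum_phase A z i M : multilinear_form A -> sup_bounded A M ->
  (forall l j, abs (z l 0 j) <= 1) ->
  \sum_j abs (A (upd z i (delta_mx 0 j))) <= M.
Proof.
move=> mA bA z1.
pose u j := s2val (cid2 (abs_phase absP (A (upd z i (delta_mx 0 j))))).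
have u1 j : abs (u j) = 1 by rewrite /u; case: cid2.
have uA j : u j * A (upd z i (delta_mx 0 j)) = iota (abs (A (upd z i (delta_mx 0 j)))).
  by rewrite /u; case: cid2.
have := bA (upd z i (\row_j u j)); rewrite ml_expand//.
under eq_bigr do rewrite mxE uA.
rewrite -rmorph_sum abs_iota ger0_norm ?sumr_ge0//; apply => l j.
by rewrite /upd; case: eqP => // _; rewrite mxE u1.
Qed.

(** [s] lists the variables still to be averaged; the others are frozen at [j0],
    hence the vanishing hypothesis. *)
Lemma mixed12_le A i (j0 : 'I_n) M (s : seq 'I_d) : i \notin s ->
  multilinear_form A -> sup_bounded A M ->
  (forall f l, l \notin i :: s -> f l != j0 -> A (basis f) = 0) ->
  mixed12 A i <= 4 ^+ size s * M.
Proof.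
elim: s A => [|l s IH] A.
  move=> _ mA bA A0; rewrite expr0 mul1r /mixed12.
  have b1 l j : abs (basis [ffun => j0] l 0 j) <= 1.
    by rewrite abs_delta; case: eqP; rewrite ?lexx ?ler01.
  apply: le_trans (row_sum_phase i mA bA b1); apply: ler_sum => j _.
  rewrite -basis_fupd (bigD1 (fupd [ffun=> j0] i j))/=; last by rewrite ffunE eqxx.
  rewrite big1 ?addr0 ?sqrtr_sqr ?ger0_norm// => f /andP[/eqP fi /eqP fN].
  have [l /andP[li fl]|H] := pickP [pred l | (l != i) && (f l != j0)].
    by rewrite (A0 f l) ?inE ?orbF ?li// (abs0 absP) expr0n.
  exfalso; apply: fN; apply/ffunP => l; rewrite !ffunE.
  case: eqP => [->//|/eqP li]; have := H l; rewrite /= li/= => /negbFE/eqP //.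
rewrite inE negb_or eq_sym => /andP[li is_] mA bA A0.
have N0 : 0 < #|{ffun 'I_n -> bool}|%:R :> R.
  by rewrite ltr0n; apply/card_gt0P; exists [ffun=> true].
rewrite -(ler_pM2r N0); apply: (le_trans (mixed12_contract j0 mA li)).
rewrite exprS -!mulrA ler_wpM2l// mulrA.
rewrite (_ : _ * _%:R = \sum_(e : {ffun 'I_n -> bool}) 4 ^+ size s * M); last first.
  by rewrite sumr_const mulr_natr.
apply: ler_sum => e _; apply: IH => //; first exact: contract_ml.
  by apply: contract_bounded => // j; rewrite mxE (abs_sign absP).
move=> f l'; rewrite inE negb_or => /andP[l'i l's] fl'; rewrite contract_basis//.
case: eqP => // fl; rewrite big1// => k _; rewrite (A0 _ l') ?mulr0//.
  rewrite !inE (negbTE l'i) (negbTE l's) orbF/=.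
  by apply/eqP => ll'; move: fl'; rewrite ll' fl eqxx.
rewrite ffunE; case: (l' =P l) => // ll'; move: fl'; by rewrite ll' fl eqxx.
Qed.

Lemma mixed_littlewood A i M : multilinear_form A -> sup_bounded A M ->
  mixed12 A i <= 4 ^+ d.-1 * M.
Proof.
move=> mA bA; have [n0|n0] := posnP n.
  rewrite /mixed12 big1 => [|[j jn] _]; last by exfalso; rewrite n0 in jn.
  apply: mulr_ge0; first by rewrite exprn_ge0.
  by apply: le_trans (abs_ge0 (A (fun=> 0))) (bA _ _) => l j; rewrite mxE (abs0 absP).
have -> : d.-1 = size (enum (predC1 i)) by rewrite -cardE cardC1 card_ord.
apply: (@mixed12_le _ _ (Ordinal n0)) => //; first by rewrite mem_enum !inE eqxx.
by move=> f l; rewrite inE mem_enum !inE orbN.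
Qed.

(** Coordinatewise multiplication by an element of the unit ball of [l_p] maps the
    unit ball of [l_oo] into that of [l_p]. *)
Lemma weighted_mixed_littlewood (p : R) A i M (x : 'I_d -> 'I_n -> R) :
  0 < p -> multilinear_form A -> ball_bounded p A M ->
  (forall l j, 0 <= x l j) -> (forall l, \sum_j x l j `^ p <= 1) ->
  \sum_j (\sum_(f : {ffun 'I_d -> 'I_n} | f i == j)
    abs (A (basis f)) ^+ 2 * \prod_l x l (f l) ^+ 2) `^ (1 / 2) <= 4 ^+ d.-1 * M.
Proof.
move=> p0 mA bA x0 x1.
pose B : form := fun z => A (fun l => \row_j (iota (x l j) * z l 0 j)).
have mB : multilinear_form B.
  apply: ml_intro => z l c u v; rewrite /B.
  have E w : (fun a => \row_j (iota (x a j) * upd z l w a 0 j)) =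
    upd (fun a => \row_j (iota (x a j) * z a 0 j)) l (\row_j (iota (x l j) * w 0 j)).
    by apply/funext => a; rewrite /upd; case: eqP => [->|].
  rewrite !E -ml_lin//; congr (A (upd _ _ _)); apply/rowP => j; rewrite !mxE.
  by rewrite mulrDr mulrCA.
have bB : sup_bounded B M.
  move=> z z1; apply: bA => l; apply: le_trans (x1 l); apply: ler_sum => j _.
  rewrite mxE ge0_ler_powR ?nnegrE ?(ltW p0)//.
  by rewrite absM abs_iota ger0_norm// ler_piMr.
have := mixed_littlewood i mB bB; apply: le_trans; apply: ler_sum => j _.
rewrite div1r powR12_sqrt; last first.
  apply: sumr_ge0 => f _; rewrite mulr_ge0 ?exprn_ge0//.
  by apply: prodr_ge0 => l _; rewrite exprn_ge0.
rewrite le_eqVlt; apply/orP; left; apply/eqP; congr Num.sqrt; apply: eq_bigr => f _.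
have -> : B (basis f) = (\prod_l iota (x l (f l))) * A (basis f).
  rewrite -ml_scale//; congr A; apply/funext => l; apply/rowP => k; rewrite !mxE.
  by case: (k =P f l) => [->|]; rewrite ?andbF ?mulr0.
rewrite absM exprMn mulrC (abs_prod absP) prodrXl; congr (_ ^+ 2 * _).
by apply: eq_bigr => l _; rewrite abs_iota ger0_norm.
Qed.

End OneForm.
End Forms.

(** * The Hardy-Littlewood inequality in few variables *)

Section HardyLittlewood.
Variables (R : realType) (d n : nat) (p : R) (g : {ffun 'I_d -> 'I_n} -> R).
Hypotheses (p0 : 0 < p) (g0 : forall f, 0 <= g f).
Implicit Types (T : {set 'I_d}) (x : 'I_d -> 'I_n -> R).

(** [T] is the set of variables whose weight has been removed; keeping a trivial weight
    there lets all stages of the induction speak of the same weighted arrays. *)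
Definition weights T x := (forall l j, 0 <= x l j) /\
  forall l, if l \in T then forall j, x l j = 1 else \sum_j x l j `^ p <= 1.

Definition weighted x (f : {ffun 'I_d -> 'I_n}) : R := g f * \prod_l x l (f l) ^+ 2.

(** [g] stands for the squared moduli of the coefficients, whence [s / 2]: this bounds a
    mixed [(l_s, l_2)] norm with the variable [i] outside.  From here to the removal of
    the last weight only nonnegative arrays matter. *)
Definition marginal_bound T (i : 'I_d) (s : R) := forall x, weights T x ->
  \sum_j (\sum_(f : {ffun 'I_d -> 'I_n} | f i == j) weighted x f) `^ (s / 2) <= 1.

Lemma weighted_ge0 x f : (forall l j, 0 <= x l j) -> 0 <= weighted x f.
Proof. by move=> x0; rewrite mulr_ge0// prodr_ge0// => l _; rewrite exprn_ge0. Qed.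

Lemma weights_upd T x k y : weights T x -> k \in T ->
  (forall j, 0 <= y j) -> \sum_j y j `^ p <= 1 -> weights (T :\ k) (upd x k y).
Proof.
move=> [x0 xT] kT y0 y1; split=> [l j|l]; rewrite /upd; first by case: eqP.
by rewrite !inE; case: (l =P k) => //= _; exact: xT.
Qed.

Lemma weighted_upd T x k y f : weights T x -> k \in T ->
  weighted (upd x k y) f = weighted x f * y (f k) ^+ 2.
Proof.
move=> [_ /(_ k)]; move=> h kT; rewrite kT in h.
rewrite /weighted (bigD1 k)//= [in RHS](bigD1 k)//= h expr1n mul1r /upd eqxx.
rewrite -mulrA [X in _ * X]mulrC; congr (_ * (_ * _)).
by apply: eq_bigr => l /negbTE ->.
Qed.

(** The weight of the variable [i] factors out of the inner sum, so removing it is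
    pure duality. *)
Lemma marginal_step_in T i l s : 0 < l -> 0 < s -> s^-1 = l^-1 - p^-1 -> i \in T ->
  marginal_bound (T :\ i) i l -> marginal_bound T i s.
Proof.
move=> l0 s0 sE iT H x xT.
pose S j := \sum_(f : {ffun 'I_d -> 'I_n} | f i == j) weighted x f.
have S0 j : 0 <= S j by apply: sumr_ge0 => f _; exact: weighted_ge0 xT.1.
suff : \sum_j (S j `^ 2^-1) `^ s <= 1 by under eq_bigr do rewrite -powRrM [_^-1 * _]mulrC.
apply: (lp_duality p0 l0 s0 sE) => [j|y y0 y1]; first exact: powR_ge0.
have := H _ (weights_upd xT iT y0 y1); apply: le_trans.
rewrite le_eqVlt; apply/orP; left; apply/eqP; apply: eq_bigr => j _.
rewrite (eq_bigr (fun f => weighted x f * y j ^+ 2)) => [|f /eqP fi]; last first.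
  by rewrite (weighted_upd _ _ xT iT) fi.
rewrite -big_distrl/= -/(S j) (powRM _ (S0 j) (exprn_ge0 2 (y0 j))).
rewrite -(powR_mulrn 2 (y0 j)) -!powRrM mulrC.
by congr (_ `^ _ * _ `^ _); field.
Qed.

(** The weight sits in an inner variable [k].  Summing out all variables but [i] and
    [k] leaves a matrix, to which the interpolation step applies; its hypothesis on
    columns is the bound with outer variable [k], already available by duality. *)
Lemma marginal_step_notin T i k l s : 0 < l -> l < s -> s < 2 -> s^-1 = l^-1 - p^-1 ->
  i \notin T -> k \in T ->
  marginal_bound (T :\ k) i l -> marginal_bound (T :\ k) k l -> marginal_bound T i s.
Proof.
move=> l0 ls s2 sE iT kT Hi Hk x xT.
have s0 : 0 < s := lt_trans l0 ls.
have ik : i != k by apply: contraNneq iT => ->.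
pose G a b := \sum_(f : {ffun 'I_d -> 'I_n} | (f i == a) && (f k == b)) weighted x f.
have G0 a b : 0 <= G a b by apply: sumr_ge0 => f _; exact: weighted_ge0 xT.1.
have rowE a (F : {ffun 'I_d -> 'I_n} -> R) : \sum_(f : {ffun 'I_d -> 'I_n} | f i == a) F f =
    \sum_b \sum_(f : {ffun 'I_d -> 'I_n} | (f i == a) && (f k == b)) F f.
  exact: (partition_big (fun f : {ffun 'I_d -> 'I_n} => f k) xpredT).
have colE b (F : {ffun 'I_d -> 'I_n} -> R) : \sum_(f : {ffun 'I_d -> 'I_n} | f k == b) F f =
    \sum_a \sum_(f : {ffun 'I_d -> 'I_n} | (f i == a) && (f k == b)) F f.
  rewrite (partition_big (fun f : {ffun 'I_d -> 'I_n} => f i) xpredT)//=.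
  by apply: eq_bigr => a _; apply: eq_bigl => f; rewrite andbC.
under eq_bigr do rewrite rowE.
apply: (hardy_littlewood_transfer (G := G) p0 l0 ls s2 sE G0) => [y y0 y1|].
  have := Hi _ (weights_upd xT kT y0 y1); apply: le_trans.
  rewrite le_eqVlt; apply/orP; left; apply/eqP; apply: eq_bigr => a _; congr powR.
  rewrite rowE; apply: eq_bigr => b _; rewrite big_distrl/=.
  by apply: eq_bigr => f /andP[_ /eqP fk]; rewrite (weighted_upd _ _ xT kT) fk.
have := marginal_step_in l0 s0 sE kT Hk xT.
by under eq_bigr do rewrite colE.
Qed.

End HardyLittlewood.

Section Base.
Variables (R : realType) (d n m : nat) (g : {ffun 'I_d -> 'I_n} -> R).
Hypothesis g0 : forall f, 0 <= g f.
Hypothesis m0 : (0 < m)%N.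
Hypothesis base : forall i, marginal_bound m%:R g finset.set0 i 1.

Lemma marginal_lt (T : {set 'I_d}) i : (2 * #|T| < m)%N ->
  marginal_bound m%:R g T i (m%:R / (m - #|T|)%:R).
Proof.
have mp : 0 < m%:R :> R by rewrite ltr0n.
suff H k : forall (T' : {set 'I_d}) i', #|T'| = k -> (2 * k < m)%N ->
    marginal_bound m%:R g T' i' (m%:R / (m - k)%:R) by move=> Tm; exact: H.
elim: k {T i} => [|k IH] T i Tk km.
  have -> : T = finset.set0 by apply/eqP; rewrite -cards_eq0 Tk.
  by rewrite subn0 divff ?gt_eqF//; exact: base.
have km' : (2 * k < m)%N by apply: leq_ltn_trans km; rewrite leq_mul2l leqnSn orbT.
have kltm : (k.+1 < m)%N by lia.
have mk0 : 0 < (m - k)%:R :> R by rewrite ltr0n subn_gt0; lia.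
have mk1 : 0 < (m - k.+1)%:R :> R by rewrite ltr0n subn_gt0.
have E : (m - k.+1)%:R = (m - k)%:R - 1 :> R.
  by rewrite -[1]/(1%:R) -natrB ?subn_gt0 ?(ltnW kltm)//; congr _%:R; lia.
have l0 : 0 < m%:R / (m - k)%:R :> R by rewrite divr_gt0.
have s0 : 0 < m%:R / (m - k.+1)%:R :> R by rewrite divr_gt0.
have sE : (m%:R / (m - k.+1)%:R)^-1 = (m%:R / (m - k)%:R)^-1 - m%:R^-1 :> R.
  rewrite E; field; rewrite -E !gt_eqF//.
have card k' : k' \in T -> #|T :\ k'| = k.
  by move=> k'T; have := cardsD1 k' T; rewrite k'T Tk => -[].
have [iT|iT] := boolP (i \in T).
  by apply: (marginal_step_in mp g0 l0 s0 sE iT); exact: IH (card _ iT) km'.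
have [k' k'T] : exists k', k' \in T by apply/card_gt0P; rewrite Tk.
apply: (marginal_step_notin mp g0 l0 _ _ sE iT k'T); [| |exact: IH (card _ k'T) km'..].
  by rewrite ltr_pM2l// ltf_pV2// ltr_nat ltn_sub2l// ltnW.
by rewrite ltr_pdivrMr// -natrM ltr_nat; lia.
Qed.

(** One further step, by duality alone, where the exponent may reach or exceed 2 and
    interpolation is no longer available. *)
Lemma marginal_le (T : {set 'I_d}) i : i \in T -> (2 * #|T| < m + 2)%N -> (#|T| < m)%N ->
  marginal_bound m%:R g T i (m%:R / (m - #|T|)%:R).
Proof.
move=> iT h1 h2.
have mp : 0 < m%:R :> R by rewrite ltr0n.
have TE : #|T| = #|T :\ i|.+1 by rewrite (cardsD1 i) iT.
rewrite TE in h1 h2 *; set k := #|T :\ i| in h1 h2 *.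
have mk0 : 0 < (m - k)%:R :> R by rewrite ltr0n subn_gt0; lia.
have mk1 : 0 < (m - k.+1)%:R :> R by rewrite ltr0n subn_gt0.
have E : (m - k.+1)%:R = (m - k)%:R - 1 :> R.
  by rewrite -[1]/(1%:R) -natrB; [congr _%:R|]; lia.
have l0 : 0 < m%:R / (m - k)%:R :> R by rewrite divr_gt0.
have s0 : 0 < m%:R / (m - k.+1)%:R :> R by rewrite divr_gt0.
have sE : (m%:R / (m - k.+1)%:R)^-1 = (m%:R / (m - k)%:R)^-1 - m%:R^-1 :> R.
  rewrite E; field; rewrite -E !gt_eqF//.
apply: (marginal_step_in mp g0 l0 s0 sE iT); apply: marginal_lt; rewrite -/k; lia.
Qed.
End Base.

Section FormBound.
Variables (R : realType) (K : fieldType) (abs : K -> R) (iota : {rmorphism R -> K}).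
Hypothesis absP : is_modulus abs iota.

(** All weights have been removed; [m/(m-d)] is the exponent [1/(1 - d/m)] of Hardy and
    Littlewood. *)
Lemma hardy_littlewood (d n m : nat) (A : ('I_d -> 'rV[K]_n) -> K) (i : 'I_d) (M : R) :
  (2 * d < m + 2)%N -> (d < m)%N -> 0 < M ->
  multilinear_form A -> ball_bounded abs m%:R A M ->
  \sum_j (\sum_(f : {ffun 'I_d -> 'I_n} | f i == j) abs (A (basis K f)) ^+ 2)
     `^ (m%:R / (m - d)%:R / 2) <= (4 ^+ d.-1 * M) `^ (m%:R / (m - d)%:R).
Proof.
move=> dm dm' M0 mA bA; set C := 4 ^+ d.-1 * M; set s := m%:R / _.
have m0 : (0 < m)%N by apply: leq_ltn_trans dm'.
have mp : 0 < m%:R :> R by rewrite ltr0n.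
have C0 : 0 < C by rewrite mulr_gt0// exprn_gt0.
pose g (f : {ffun 'I_d -> 'I_n}) := (abs (A (basis K f)) / C) ^+ 2.
have g0 f : 0 <= g f by rewrite exprn_ge0// divr_ge0 ?(abs_ge0 absP)// ltW.
have sq_scale (F : {ffun 'I_d -> 'I_n} -> R) (P : pred {ffun 'I_d -> 'I_n}) (r : R) :
    (forall f, 0 <= F f) ->
    (\sum_(f | P f) F f / C ^+ 2) `^ (r / 2) = (\sum_(f | P f) F f) `^ (r / 2) / C `^ r.
  move=> F0; rewrite -big_distrl/= powRM ?sumr_ge0 ?invr_ge0 ?exprn_ge0 ?(ltW C0)//.
  congr (_ * _); rewrite -exprVn -powR_mulrn ?invr_ge0 ?(ltW C0)// -powRrM mulrC divfK//.
  by rewrite -(@powR_inv1 _ C) ?(ltW C0)// -powRrM mulN1r powRN.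
have base i' : marginal_bound m%:R g finset.set0 i' 1.
  move=> x [x0 x1].
  have x1' l : \sum_j x l j `^ m%:R <= 1 by have := x1 l; rewrite inE.
  have H := weighted_mixed_littlewood absP i' mp mA bA x0 x1'.
  rewrite (eq_bigr (fun j => (\sum_(f : {ffun 'I_d -> 'I_n} | f i' == j)
    abs (A (basis K f)) ^+ 2 * \prod_l x l (f l) ^+ 2) `^ (1 / 2) / C)) => [|j _].
    by rewrite -big_distrl/= ler_pdivrMr// !mul1r; move: H; rewrite div1r.
  rewrite -[in RHS](powRr1 (ltW C0)) -sq_scale => [|f]; last first.
    by rewrite mulr_ge0 ?exprn_ge0 ?(abs_ge0 absP)// prodr_ge0// => l _; rewrite exprn_ge0.
  congr powR; apply: eq_bigr => f _; rewrite /weighted /g expr_div_n mulrAC//.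
have ones : weights m%:R (finset.setT : {set 'I_d}) (fun _ (_ : 'I_n) => 1 : R).
  by split=> [_ _|l]; [exact: ler01|rewrite finset.in_setT].
have := marginal_le g0 m0 base (finset.in_setT i).
rewrite finset.cardsT card_ord => /(_ dm dm' _ ones) H.
rewrite -[leRHS]mul1r -ler_pdivrMr ?powR_gt0// big_distrl/=.
apply: le_trans H.
rewrite le_eqVlt; apply/orP; left; apply/eqP; apply: eq_bigr => j _.
rewrite -sq_scale => [|f]; last by rewrite exprn_ge0// (abs_ge0 absP).
congr powR; apply: eq_bigr => f _; rewrite /weighted /g big1 ?mulr1 ?expr_div_n// => l _.
by rewrite expr1n.
Qed.
End FormBound.

(** * Iterated norms and their cotype *)

Section MixedNorm.
Variable R : realType.
Implicit Types (n d : nat).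

Lemma lnorm_ge0 n (t : \bar R) (x : 'I_n -> R) : 0 <= lnorm t x.
Proof.
case: t => [r||] //=; first exact: powR_ge0.
by elim/big_ind: _ => // a b a0 b0; rewrite le_max a0.
Qed.

Lemma mixed_norm_ge0 n d (t : 'I_d -> \bar R) (a : d.-tuple 'I_n -> R) :
  (forall js, 0 <= a js) -> 0 <= mixed_norm t a.
Proof. by case: d t a => [|d] t a a0 //=; exact: lnorm_ge0. Qed.

Lemma eq_mixed_norm n d (t : 'I_d -> \bar R) (a b : d.-tuple 'I_n -> R) :
  a =1 b -> mixed_norm t a = mixed_norm t b.
Proof. by move=> ab; congr mixed_norm; exact/funext. Qed.

Lemma mixed_normS n d (r : 'I_d.+1 -> R) (a : d.+1.-tuple 'I_n -> R) :
  (forall js, 0 <= a js) ->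
  mixed_norm (fun i => (r i)%:E) a =
  (\sum_j mixed_norm (fun i => (r (lift ord0 i))%:E)
     (fun js : d.-tuple 'I_n => a [tuple of j :: js]) `^ r ord0) `^ (r ord0)^-1.
Proof.
move=> a0 /=; congr powR; apply: eq_bigr => j _.
by rewrite ger0_norm ?mixed_norm_ge0.
Qed.

Lemma mixed_normZ n d (r : 'I_d -> R) (a : d.-tuple 'I_n -> R) (c : R) :
  (forall i, 0 < r i) -> 0 <= c -> (forall js, 0 <= a js) ->
  mixed_norm (fun i => (r i)%:E) (fun js => c * a js) =
  c * mixed_norm (fun i => (r i)%:E) a.
Proof.
elim: d r a => [//|d IH] r a r0 c0 a0.
rewrite !mixed_normS// => [|js]; last by rewrite mulr_ge0.
under eq_bigr => j _.
  rewrite (IH (fun i => r (lift ord0 i)) (fun js => a [tuple of j :: js]))//.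
  rewrite powRM ?mixed_norm_ge0//.
  over.
rewrite -big_distrr/= powRM ?powR_ge0//; last by apply: sumr_ge0 => j _; exact: powR_ge0.
by rewrite -powRrM mulfV ?gt_eqF// powRr1.
Qed.

Lemma sum_tupleS n d (F : d.+1.-tuple 'I_n -> R) :
  \sum_t F t = \sum_j \sum_(t : d.-tuple 'I_n) F [tuple of j :: t].
Proof.
rewrite pair_big/=.
rewrite (reindex (fun q : 'I_n * d.-tuple 'I_n => [tuple of q.1 :: q.2]))//=.
exists (fun t : d.+1.-tuple 'I_n => (thead t, [tuple of behead t])) => [[j t] _|t _] /=.
  by congr pair; apply: val_inj.
by rewrite -tuple_eta.
Qed.

Lemma mixed_norm2 n d (a : d.-tuple 'I_n -> R) : (forall js, 0 <= a js) ->
  mixed_norm (fun=> 2%:E) a = (\sum_js a js ^+ 2) `^ 2^-1.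
Proof.
elim: d a => [|d IH] a a0.
  rewrite (bigD1 [tuple])//= big1 => [|t]; last by rewrite (tuple0 t) => /eqP.
  by rewrite addr0 powR12_sqrt ?exprn_ge0// sqrtr_sqr ger0_norm.
rewrite (mixed_normS (fun=> 2) a0) sum_tupleS; congr powR; apply: eq_bigr => j _.
rewrite (IH (fun js => a [tuple of j :: js]))// -powRrM mulVf ?powRr1//.
by apply: sumr_ge0 => js _; rewrite exprn_ge0.
Qed.

Lemma sum_ffun_head n d (j : 'I_n) (F : {ffun 'I_d.+1 -> 'I_n} -> R) :
  \sum_(f : {ffun 'I_d.+1 -> 'I_n} | f ord0 == j) F f =
  \sum_(t : d.-tuple 'I_n) F [ffun i => tnth [tuple of j :: t] i].
Proof.
rewrite (reindex_onto (fun t : d.-tuple 'I_n => [ffun i => tnth [tuple of j :: t] i])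
  (fun f : {ffun 'I_d.+1 -> 'I_n} => [tuple f (lift ord0 i) | i < d]))/=.
  apply: eq_bigl => t; rewrite ffunE tnth0 eqxx/=; apply/eqP/eq_from_tnth => i.
  by rewrite tnth_mktuple ffunE tnthS.
move=> f /eqP fj; apply/ffunP => i; rewrite ffunE.
case: (unliftP ord0 i) => [i' ->|->]; last by rewrite tnth0.
by rewrite tnthS tnth_mktuple.
Qed.

End MixedNorm.

Section Cotype.
Variables (R : realType) (K : fieldType) (abs : K -> R) (iota : {rmorphism R -> K}).
Hypothesis absP : is_modulus abs iota.

(** Cotype [q] of the iterated norm.  In dimension zero, the [q]-th power mean dominates
    the quadratic mean as [q >= 2], the latter is the [l_2] norm, and [l_2] dominates
    [l_q].  Each further index [x] of outer
    exponent [r0 <= q] costs nothing: the [q/r0]-th power mean dominates the mean,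
    the induction hypothesis applies for each [x] with [q] replaced by [r0], and
    [l_1] dominates [l_(q/r0)]. *)
Lemma mixed_norm_cotype (J : finType) n d (r : 'I_d -> R) (q : R)
    (b : J -> d.-tuple 'I_n -> K) :
  (forall i, 2 <= r i) -> (forall i j : 'I_d, (i <= j)%N -> r j <= r i) ->
  2 <= q -> (forall i, r i <= q) ->
  \sum_j mixed_norm (fun i => (r i)%:E) (fun js => abs (b j js)) `^ q <=
  \sum_(e : {ffun J -> bool}) #|{ffun J -> bool}|%:R^-1 *
    mixed_norm (fun i => (r i)%:E) (fun js => abs (\sum_j (-1) ^+ e j * b j js)) `^ q.
Proof.
set w : R := _^-1.
have cN : #|{ffun J -> bool}|%:R != 0 :> R.
  by rewrite pnatr_eq0 -lt0n; apply/card_gt0P; exists [ffun=> true].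
have w0 : 0 <= w by rewrite invr_ge0 ler0n.
have w1 : \sum_(e : {ffun J -> bool}) w = 1.
  by rewrite sumr_const -[_ *+ _]mulr_natr mulVf.
elim: d r q b => [|d IH] r q b r2 rdec q2 rq.
  rewrite /=; have q0 : 0 < q by apply: lt_le_trans q2.
  have h1 : 1 <= q / 2 by rewrite ler_pdivlMr// mul1r.
  have sqE (x : K) : abs x `^ q = (abs x ^+ 2) `^ (q / 2).
    by rewrite -powR_mulrn ?(abs_ge0 absP)// -powRrM mulrC divfK.
  have [m2 _] := rademacher_moments absP (fun j (_ : 'I_1) => b j [tuple]) (index_enum_uniq J).
  under eq_bigr do rewrite sqE; under [leRHS]eq_bigr do rewrite sqE.
  apply: (le_trans (sum_powR_le xpredT h1 (fun j => exprn_ge0 2 (abs_ge0 absP _)))).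
  apply: le_trans (power_mean h1 (fun=> w0) w1 (fun e => exprn_ge0 2 (abs_ge0 absP _))).
  rewrite le_eqVlt; apply/orP; left; apply/eqP; congr powR.
  rewrite -big_distrr/=; apply: (mulfI cN); rewrite mulrA mulfV// mul1r.
  rewrite (_ : \sum_j abs (b j [tuple]) ^+ 2 =
    \sum_(j <- index_enum J) vsq abs (fun _ : 'I_1 => b j [tuple])); last first.
    by apply: eq_bigr => j _; rewrite /vsq big_ord1.
  by rewrite -m2; apply: eq_bigr => e _; rewrite /vsq big_ord1.
set r0 := r ord0.
have r02 : 2 <= r0 by exact: r2.
have r0p : 0 < r0 by apply: lt_le_trans r02.
have h1 : 1 <= q / r0 by rewrite ler_pdivlMr// mul1r; exact: rq.
pose r' i := r (lift ord0 i).
pose N (c : d.-tuple 'I_n -> K) := mixed_norm (fun i => (r' i)%:E) (fun js => abs (c js)).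
have N0 c : 0 <= N c by apply: mixed_norm_ge0 => js; exact: (abs_ge0 absP).
have NE (c : d.+1.-tuple 'I_n -> K) :
    mixed_norm (fun i => (r i)%:E) (fun js => abs (c js)) `^ q =
    (\sum_x N (fun js => c [tuple of x :: js]) `^ r0) `^ (q / r0).
  rewrite mixed_normS => [|js]; last exact: (abs_ge0 absP).
  by rewrite -powRrM mulrC.
have IH' x := IH r' r0 (fun j js => b j [tuple of x :: js])
  (fun i => r2 _) (fun i j ij => rdec (lift ord0 i) (lift ord0 j) ij) r02
  (fun i => rdec ord0 (lift ord0 i) isT).
under eq_bigr do rewrite NE.
under [leRHS]eq_bigr => e _ do rewrite NE.
have S0 (c : d.+1.-tuple 'I_n -> K) : 0 <= \sum_x N (fun js => c [tuple of x :: js]) `^ r0.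
  by apply: sumr_ge0 => x _; exact: powR_ge0.
apply: (le_trans (sum_powR_le xpredT h1 (fun j => S0 (b j)))).
apply: le_trans (power_mean h1 (fun=> w0) w1
  (fun e : {ffun J -> bool} => S0 (fun js => \sum_j (-1) ^+ e j * b j js))).
rewrite ge0_ler_powR ?nnegrE//.
- by apply: le_trans h1.
- by apply: sumr_ge0 => j _.
- by apply: sumr_ge0 => e _; exact: mulr_ge0 w0 (S0 (fun js => \sum_j (-1) ^+ e j * b j js)).
rewrite exchange_big/=; under [leRHS]eq_bigr do rewrite big_distrr/=.
by rewrite [leRHS]exchange_big/=; apply: ler_sum => x _; exact: IH'.
Qed.

End Cotype.

(** * The upper bound *)

Section UpperBound.
Variables (R : realType) (K : fieldType) (abs : K -> R) (iota : {rmorphism R -> K}).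
Hypothesis absP : is_modulus abs iota.
Let absM := absM absP.
Let abs_ge0 := abs_ge0 absP.
Let abs_iota := abs_iota absP.

Lemma vnorm_le1 n m (x : 'rV[K]_n) : (0 < m)%N ->
  (vnorm abs m%:R%:E x <= 1) = (\sum_j abs (x 0 j) `^ m%:R <= 1).
Proof.
move=> m0; have mp : 0 < m%:R :> R by rewrite ltr0n.
rewrite /vnorm /=; under eq_bigr do rewrite ger0_norm//.
set S := \sum_j _; have S0 : 0 <= S by apply: sumr_ge0 => j _; exact: powR_ge0.
apply/idP/idP => h; last first.
  rewrite -[leRHS](_ : 1 `^ m%:R^-1 = 1); last by rewrite powR1.
  by rewrite ge0_ler_powR ?nnegrE ?invr_ge0 ?ler01 ?(ltW mp).
rewrite leNgt; apply/negP => S1; move: h; rewrite leNgt => /negP; apply.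
rewrite -[ltLHS](_ : 1 `^ m%:R^-1 = 1); last by rewrite powR1.
by rewrite gt0_ltr_powR ?nnegrE ?invr_gt0 ?ler01.
Qed.

Lemma ball_coord (p : R) n (z : 'I_n -> R) j : 0 < p -> (forall j, 0 <= z j) ->
  \sum_j z j `^ p <= 1 -> z j <= 1.
Proof.
move=> p0 z0 z1; rewrite leNgt; apply/negP => zj.
move: z1; rewrite leNgt => /negP; apply.
apply: (@lt_le_trans _ _ (z j `^ p)).
  rewrite -[ltLHS](_ : 1 `^ p = 1); last by rewrite powR1.
  by rewrite gt0_ltr_powR ?nnegrE ?ler01.
by rewrite (bigD1 j)//= lerDl sumr_ge0// => i _; exact: powR_ge0.
Qed.

Lemma form_norm_le m n (A : ('I_m -> 'rV[K]_n) -> K) M : (0 < m)%N ->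
  ball_bounded abs m%:R A M -> form_norm abs A <= M.
Proof.
move=> m0 bA; apply: ge_sup => [|_ [z z1 ->]].
  exists (abs (A (fun=> 0))), (fun=> 0) => // j.
  rewrite vnorm_le1// big1 ?ler01// => i _.
  by rewrite mxE (abs0 absP) powR0// pnatr_eq0 -lt0n.
by apply: bA => l; rewrite -vnorm_le1.
Qed.

Lemma form_normP m n (A : ('I_m -> 'rV[K]_n) -> K) : (0 < m)%N ->
  multilinear_form A -> ball_bounded abs m%:R A (form_norm abs A).
Proof.
move=> m0 mA z z1; have [C HC] := ml_bounded absP mA.
apply: ub_le_sup; last by exists z => // l; rewrite vnorm_le1.
exists C => _ [z' z'1 ->]; apply: HC => l j.
apply: (@ball_coord m%:R n (fun j => abs (z' l 0 j))); rewrite ?ltr0n//.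
by rewrite -vnorm_le1.
Qed.

Lemma form_norm_ge0 m n (A : ('I_m -> 'rV[K]_n) -> K) : (0 < m)%N ->
  multilinear_form A -> 0 <= form_norm abs A.
Proof.
move=> m0 mA; apply: le_trans (abs_ge0 (A (fun=> 0))) (form_normP m0 mA _) => l.
by rewrite big1 ?ler01// => i _; rewrite mxE (abs0 absP) powR0// pnatr_eq0 -lt0n.
Qed.

Definition fcons (V : Type) d (x : V) (z : 'I_d -> V) : 'I_d.+1 -> V :=
  fun i => if unlift ord0 i is Some j then z j else x.

Lemma fcons0 V d (x : V) (z : 'I_d -> V) : fcons x z ord0 = x.
Proof. by rewrite /fcons unlift_none. Qed.

Lemma fconsS V d (x : V) (z : 'I_d -> V) j : fcons x z (lift ord0 j) = z j.
Proof. by rewrite /fcons liftK. Qed.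

Lemma fcons_upd V d (x : V) (z : 'I_d -> V) i v :
  fcons x (upd z i v) = upd (fcons x z) (lift ord0 i) v.
Proof.
apply/funext => k; case: (unliftP ord0 k) => [k' ->|->].
  by rewrite fconsS /upd fconsS (inj_eq lift_inj).
by rewrite fcons0 /upd fcons0 eq_sym; case: eqP => // /eqP; rewrite eq_sym (negbTE (neq_lift _ _)).
Qed.

Lemma fcons_head V d (x y : V) (z : 'I_d -> V) : fcons x z = upd (fcons y z) ord0 x.
Proof.
apply/funext => k; case: (unliftP ord0 k) => [k' ->|->].
  by rewrite /upd eq_sym (negbTE (neq_lift _ _)) !fconsS.
by rewrite /upd eqxx fcons0.
Qed.

Definition slice d n (A : ('I_d.+1 -> 'rV[K]_n) -> K) (x : 'rV[K]_n) :
  ('I_d -> 'rV[K]_n) -> K := fun z => A (fcons x z).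

Lemma slice_ml d n (A : ('I_d.+1 -> 'rV[K]_n) -> K) x :
  multilinear_form A -> multilinear_form (slice A x).
Proof.
by move=> mA; apply: ml_intro => z i c u v; rewrite /slice !fcons_upd ml_lin.
Qed.

Lemma slice_bounded d n (A : ('I_d.+1 -> 'rV[K]_n) -> K) (x : 'rV[K]_n) p M :
  ball_bounded abs p A M -> \sum_j abs (x 0 j) `^ p <= 1 ->
  ball_bounded abs p (slice A x) M.
Proof.
move=> bA x1 z z1; apply: bA => l.
by case: (unliftP ord0 l) => [l' ->|->]; rewrite ?fcons0 ?fconsS.
Qed.

Lemma slice_coef d n (A : ('I_d.+1 -> 'rV[K]_n) -> K) j (js : d.-tuple 'I_n) :
  form_coef abs A [tuple of j :: js] = form_coef abs (slice A (delta_mx 0 j)) js.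
Proof.
congr (abs (A _)); apply/funext => i.
by case: (unliftP ord0 i) => [i' ->|->]; rewrite ?fconsS ?tnthS ?fcons0 ?tnth0.
Qed.

Lemma ball_delta n m (j : 'I_n) : (0 < m)%N ->
  \sum_k abs ((delta_mx 0 j : 'rV[K]_n) 0 k) `^ m%:R <= 1.
Proof.
move=> m0; rewrite (bigD1 j)//= big1 => [|k /negbTE kj].
  by rewrite (abs_delta absP) eqxx powR1 addr0.
by rewrite (abs_delta absP) kj powR0// pnatr_eq0 -lt0n.
Qed.

(** The exponents of the theorem at the positions after the first, as real numbers; [i]
    is the position counted from 0. *)
Definition exponent (m i : nat) : R := if (i.+1 <= k0 m)%N then m%:R / i%:R else 2.

Lemma exponent_ge2 m i : (0 < i)%N -> 2 <= exponent m i.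
Proof.
move=> i0; rewrite /exponent; case: ltnP => // ik.
rewrite ler_pdivlMr ?ltr0n// -natrM ler_nat; move: ik; rewrite /k0; lia.
Qed.

Lemma exponent_decr m i j : (0 < i)%N -> (i <= j)%N -> exponent m j <= exponent m i.
Proof.
move=> i0 ij; rewrite {1}/exponent; case: ltnP => jk; last exact: exponent_ge2.
rewrite /exponent (leq_ltn_trans ij jk).
by rewrite ler_wpM2l ?ler0n// lef_pV2 ?posrE ?ltr0n ?ler_nat// (leq_trans i0).
Qed.

(** The inequality for forms in the last [d] of the [m] variables. *)
Definition inequality_for (m d : nat) (C : R) :=
  forall n (A : ('I_d -> 'rV[K]_n) -> K) M, 0 < M ->
  multilinear_form A -> ball_bounded abs m%:R A M ->
  mixed_norm (fun i : 'I_d => (exponent m (m - d + i))%:E) (form_coef abs A) <= C * M.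

Lemma powR_root_le (x y s : R) : 0 < s -> 0 <= x -> 0 <= y -> x <= y `^ s -> x `^ s^-1 <= y.
Proof.
move=> s0 x0 y0 xy; rewrite -[leRHS]powRr1// -[X in _ <= _ `^ X](mulfV (lt0r_neq0 s0)) powRrM.
by rewrite ge0_ler_powR ?nnegrE ?powR_ge0 ?invr_ge0 ?(ltW s0).
Qed.

(** At [d = m - k_0 + 1] the exponents are [(s_{k_0}, 2, ..., 2)], and the iterated
    [l_2] norm is a plain [l_2] norm. *)
Lemma inequality_base m : (2 <= m)%N ->
  inequality_for m (m - k0 m).+1 (4 ^+ (m - k0 m)).
Proof.
move=> m2 n A M M0 mA bA; set d' := (m - k0 m)%N in A mA bA *.
have k02 : (2 <= k0 m <= m)%N by rewrite /k0; lia.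
have md : (m - d'.+1 = (k0 m).-1)%N by rewrite /d'; lia.
pose s : R := m%:R / (m - d'.+1)%:R.
have s0 : 0 < s by rewrite divr_gt0// ltr0n; lia.
have E : (fun i : 'I_d'.+1 => (exponent m (m - d'.+1 + i))%:E) =
    (fun i => (if i == ord0 then s else 2)%:E).
  apply/funext => i; congr (_%:E); rewrite md /exponent.
  case: (unliftP ord0 i) => [i' ->|->] /=.
    by rewrite ifF// /bump /=; lia.
  by rewrite addn0 prednK ?leqnn /s ?md//; lia.
rewrite E mixed_normS => [|js]; last exact: abs_ge0.
rewrite eqxx; apply: powR_root_le => //.
- by apply: sumr_ge0 => j _; exact: powR_ge0.
- by rewrite mulr_ge0 ?exprn_ge0 ?ltW.
have := @hardy_littlewood _ _ _ _ absP _ n m A ord0 M _ _ M0 mA bA.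
rewrite -/s => H; apply: le_trans (H _ _); [|rewrite /d' /k0; lia..].
rewrite le_eqVlt; apply/orP; left; apply/eqP; apply: eq_bigr => j _.
rewrite sum_ffun_head.
rewrite (_ : (fun i : 'I_d' => _) = fun=> 2%:E); last first.
  by apply/funext => i; rewrite eq_sym (negbTE (neq_lift _ _)).
rewrite mixed_norm2 => [|js]; last exact: abs_ge0.
rewrite -powRrM [_^-1 * _]mulrC; congr (_ `^ _); apply: eq_bigr => js _.
congr (abs (A _) ^+ 2); apply/funext => i; rewrite /basis ffunE.
by [].
Qed.

(** Substituting for the first variable the vector [(e_j y_j)], with signs [e] and [y] in
    the ball of [l_m], gives a form in [d] variables with the same bound.  Averaging
    over [e], the cotype of the iterated norm bounds the [l_q] sum of [y_j] times the
    norm of the [j]-th slice; duality in [y] then replaces [q] by [s]. *)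
Lemma inequality_step m d C : 0 < C -> (m - k0 m < d)%N -> (d.+1 < m)%N ->
  inequality_for m d C -> inequality_for m d.+1 C.
Proof.
move=> C0 kd dm IH n A M M0 mA bA.
have m0 : (0 < m)%N by lia.
have mp : 0 < m%:R :> R by rewrite ltr0n.
pose s := exponent m (m - d.+1); pose q := exponent m (m - d).
have md : (m - d = (m - d.+1).+1)%N by lia.
have s0 : 0 < s by apply: lt_le_trans (exponent_ge2 m _) => //; lia.
have q2 : 2 <= q by apply: exponent_ge2; lia.
have q0 : 0 < q by apply: lt_le_trans q2.
have sq : s^-1 = q^-1 - m%:R^-1.
  rewrite /s /q /exponent !ifT; [|lia..].
  rewrite md -natr1; field; rewrite natr1 !pnatr_eq0; lia.
pose r (i : 'I_d) := exponent m (m - d + i).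
have r2 i : 2 <= r i by apply: exponent_ge2; lia.
have rE : (fun i : 'I_d => (exponent m (m - d.+1 + lift ord0 i))%:E) = fun i => (r i)%:E.
  by apply/funext => i; congr (exponent m _)%:E; rewrite /= /bump /=; lia.
rewrite mixed_normS => [|js]; last exact: abs_ge0.
rewrite addn0 -/s rE; apply: powR_root_le => //.
- by apply: sumr_ge0 => j _; exact: powR_ge0.
- by rewrite mulr_ge0 ?ltW.
pose b j (js : d.-tuple 'I_n) := A (fcons (delta_mx 0 j) (fun i => delta_mx 0 (tnth js i))).
have bE j : (fun js : d.-tuple 'I_n => form_coef abs A [tuple of j :: js]) = fun js => abs (b j js).
  by apply/funext => js; rewrite slice_coef.
under eq_bigr do rewrite bE.
apply: (lp_duality_scaled mp q0 s0 sq (mulr_gt0 C0 M0)) => [j|y y0 y1].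
  by apply: mixed_norm_ge0 => js; exact: abs_ge0.
have rdec (i j : 'I_d) : (i <= j)%N -> r j <= r i by move=> ij; apply: exponent_decr; lia.
have rq (i : 'I_d) : r i <= q by apply: exponent_decr; lia.
have H := mixed_norm_cotype absP (fun j js => iota (y j) * b j js) r2 rdec q2 rq.
apply: (@le_trans _ _ (\sum_j mixed_norm (fun i => (r i)%:E)
    (fun js => abs (iota (y j) * b j js)) `^ q)).
  apply: ler_sum => j _; rewrite -powRM//; last by apply: mixed_norm_ge0 => js; exact: abs_ge0.
  rewrite -mixed_normZ// => [|i]; last exact: lt_le_trans (r2 i).
  rewrite le_eqVlt; apply/orP; left; apply/eqP; congr (_ `^ _).
  by apply: eq_mixed_norm => js; rewrite absM abs_iota ger0_norm.
apply: (le_trans H).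
have cN : #|{ffun 'I_n -> bool}|%:R != 0 :> R.
  by rewrite pnatr_eq0 -lt0n; apply/card_gt0P; exists [ffun=> true].
rewrite -[leRHS]mul1r -[X in X * _](mulVf cN) -big_distrr/= -mulrA ler_wpM2l ?invr_ge0//.
rewrite mulr_natl -sumr_const; apply: ler_sum => e _.
rewrite ge0_ler_powR ?nnegrE ?(ltW q0)//.
- by apply: mixed_norm_ge0 => js; exact: abs_ge0.
- by rewrite mulr_ge0 ?ltW.
pose v : 'rV[K]_n := \row_j ((-1) ^+ e j * iota (y j)).
have v1 : \sum_j abs (v 0 j) `^ m%:R <= 1.
  by under eq_bigr do rewrite mxE absM (abs_sign absP) mul1r abs_iota ger0_norm//.
have := IH _ _ _ M0 (slice_ml v mA) (slice_bounded bA v1).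
apply: le_trans; rewrite le_eqVlt; apply/orP; left; apply/eqP.
apply: eq_mixed_norm => js; rewrite /form_coef /slice (fcons_head v 0) ml_expand//.
congr abs; apply: eq_bigr => j _.
by rewrite mxE -mulrA /b (fcons_head (delta_mx 0 j) 0).
Qed.

Lemma inequality_all m d : (2 <= m)%N -> (m - k0 m < d)%N -> (d < m)%N ->
  inequality_for m d (4 ^+ (m - k0 m)).
Proof.
move=> m2; elim: d => // d IH; rewrite ltnS leq_eqVlt => /predU1P[<- _|kd dm].
  exact: inequality_base.
by apply: inequality_step => //; apply: IH => //; exact: ltnW.
Qed.

(** The outermost supremum is taken over the slices of the form.  The norm may vanish,
    whereas the bounds above are stated for a positive [M]: hence the [eps]. *)
Lemma s_exp_inequality m : (2 <= m)%N -> exists C : R, forall n, (0 < n)%N ->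
  forall A : ('I_m -> 'rV[K]_n) -> K, multilinear_form A ->
  mixed_norm (@s_exp R m) (form_coef abs A) <= C * form_norm abs A.
Proof.
move=> m2; exists (4 ^+ (m - k0 m)) => n n0 A mA.
set C := 4 ^+ _; have C0 : 0 < C :> R by rewrite exprn_gt0.
have m0 : (0 < m)%N by lia.
have N0 := form_norm_ge0 m0 mA; have NP := form_normP m0 mA.
have : inequality_for m m.-1 C by apply: inequality_all => //; rewrite /k0; lia.
move: (form_norm abs A) N0 NP; case: m m2 m0 A mA C C0 => // d m2 m0 A mA C C0 N N0 NP H.
rewrite /= /s_exp /=; apply: bigmax_le => [|j _]; first by rewrite mulr_ge0// ltW.
rewrite ger0_norm; last by apply: mixed_norm_ge0 => js; exact: abs_ge0.
apply/ler_addgt0Pr => eps eps0.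
have M0 : 0 < N + eps / C by rewrite ltr_wpDl// divr_gt0.
have bA : ball_bounded abs d.+1%:R A (N + eps / C).
  by move=> z z1; apply: le_trans (NP z z1) _; rewrite lerDl divr_ge0// ltW.
have := H n _ _ M0 (slice_ml (delta_mx 0 j) mA) (slice_bounded bA (ball_delta j m0)).
rewrite mulrDr mulrCA mulfV ?gt_eqF// mulr1; apply: le_trans.
rewrite le_eqVlt; apply/orP; left; apply/eqP.
rewrite (_ : (fun js : d.-tuple 'I_n => _) = form_coef abs (slice A (delta_mx 0 j))); last first.
  by apply/funext => js; rewrite slice_coef.
congr mixed_norm; apply/funext => i; rewrite /exponent subSnn /= /bump/= add1n.
by case: ifP.
Qed.
End UpperBound.

(** * Sharpness *)

Section LowerBound.
Variable R : realType.

Definition einv (t : \bar R) : R := if t is r%:E then r^-1 else 0.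

Lemma lnorm_ge_coord n (t : \bar R) (x : 'I_n -> R) j : (0 < t)%E ->
  `|x j| <= lnorm t x.
Proof.
case: t => [r||] //= r0; last by apply: (le_bigmax 0 (fun j => `|x j|)).
rewrite lte_fin in r0.
rewrite -[leLHS]powRr1// -[X in _ `^ X <= _](mulfV (lt0r_neq0 r0)) powRrM.
rewrite ge0_ler_powR ?nnegrE ?powR_ge0 ?invr_ge0 ?(ltW r0)//.
  by apply: sumr_ge0 => i _; exact: powR_ge0.
by rewrite (bigD1 j)//= lerDl sumr_ge0// => i _; exact: powR_ge0.
Qed.

Lemma lnorm_ge_cst n (t : \bar R) (x : 'I_n -> R) c : (0 < n)%N -> (0 < t)%E ->
  0 <= c -> (forall j, c <= `|x j|) -> n%:R `^ einv t * c <= lnorm t x.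
Proof.
move=> n0 t0 c0 cx; case: t t0 => [r||] //= t0; last first.
  rewrite powRr0 mul1r; apply: le_trans (cx (Ordinal n0)) _.
  exact: (lnorm_ge_coord x (Ordinal n0) t0).
rewrite lte_fin in t0.
rewrite -[X in _ * X]powRr1// -[X in _ * _ `^ X](mulfV (lt0r_neq0 t0)) powRrM.
rewrite -powRM ?ler0n ?powR_ge0//.
rewrite ge0_ler_powR ?nnegrE ?invr_ge0 ?(ltW t0) ?mulr_ge0 ?ler0n ?powR_ge0//.
  by apply: sumr_ge0 => i _; exact: powR_ge0.
rewrite mulr_natl -[n in X in X <= _]card_ord -sumr_const.
by apply: ler_sum => j _; rewrite ge0_ler_powR ?nnegrE ?(ltW t0).
Qed.

(** An index at a free position contributes the factor [n^(1/t)]; at the other positions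
    a single value of the index, which [phi] computes from the previous indices,
    suffices. *)
Lemma mixed_norm_lower n m (t : 'I_m -> \bar R) (a : m.-tuple 'I_n -> R)
    (free : nat -> bool) (phi : nat -> seq 'I_n -> 'I_n) :
  (0 < n)%N -> (forall i, 0 < t i)%E -> (forall js, 0 <= a js) ->
  (forall js : m.-tuple 'I_n,
     (forall l : 'I_m, ~~ free l -> tnth js l = phi l (take l js)) -> 1 <= a js) ->
  \prod_(i < m) (if free i then n%:R `^ einv (t i) else 1) <= mixed_norm t a.
Proof.
move=> n0; elim: m t a free phi => [|m IH] t a free phi t0 a0 H.
  by rewrite big_ord0 /=; apply: H; case.
rewrite big_ord_recl /=; set c := \prod_(i < m) _.
have c0 : 0 <= c by apply: prodr_ge0 => i _; case: ifP => // _; exact: powR_ge0.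
pose N j := mixed_norm (fun i => t (lift ord0 i)) (fun js : m.-tuple 'I_n => a [tuple of j :: js]).
have N0 j : 0 <= N j by apply: mixed_norm_ge0.
have Nc j : (~~ free 0 -> j = phi 0 [::]) -> c <= `|N j|.
  move=> hj; rewrite ger0_norm//.
  apply: (IH _ _ (fun l => free l.+1) (fun l s => phi l.+1 (j :: s))) => // js hjs.
  apply: H => l; case: (unliftP ord0 l) => [l' ->|->].
    by rewrite tnthS => /hjs.
  by rewrite tnth0 => /hj.
case f0 : (free 0%N); first by apply: lnorm_ge_cst => // j; apply: Nc; rewrite f0.
rewrite mul1r; apply: le_trans (Nc (phi 0%N [::]) (fun=> erefl)) _.
exact: (lnorm_ge_coord N).
Qed.

Lemma growth (C al be : R) :
  (forall r : nat, (2 ^ r)%:R `^ al <= C * (2 ^ r)%:R `^ be) -> al <= be.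
Proof.
move=> H; rewrite leNgt; apply/negP => ba.
pose q : R := 2 `^ (al - be).
have q1 : 1 < q.
  rewrite -[ltLHS](_ : 1 `^ (al - be) = 1); last by rewrite powR1.
  by rewrite gt0_ltr_powR ?subr_gt0 ?nnegrE ?ltr1n.
have qC r : q ^+ r <= C.
  have e (x : R) : (2 ^ r)%:R `^ x = (2 `^ x) ^+ r.
    by rewrite natrX -(powR_mulrn r (ler0n R 2)) -(powR_mulrn r (powR_ge0 2 x)) -!powRrM mulrC.
  have := H r; rewrite !e -ler_pdivrMr ?exprn_gt0 ?powR_gt0//.
  by rewrite -expr_div_n -powRB ?implybT// pnatr_eq0 implybT.
have bern r : 1 + r%:R * (q - 1) <= q ^+ r.
  elim: r => [|r IH]; first by rewrite mul0r addr0.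
  have r0 : 0 <= r%:R :> R by [].
  rewrite exprS -natr1; have : q * (1 + r%:R * (q - 1)) <= q * q ^+ r.
    by rewrite ler_wpM2l// ltW// (lt_trans _ q1).
  apply: le_trans; have : 0 <= r%:R * (q - 1) ^+ 2 by rewrite mulr_ge0// sqr_ge0.
  by move: (r%:R) r0 => x *; nra.
have q0 : 0 < q - 1 by rewrite subr_gt0.
have := archi_boundP (normr_ge0 (C / (q - 1))); set b := Num.Def.archi_bound _ => hb.
have : C / (q - 1) < b%:R by apply: le_lt_trans hb; exact: ler_norm.
rewrite ltr_pdivrMr// => h.
have := le_trans (bern b) (qC b); rewrite leNgt => /negP; apply.
by apply: lt_trans h _; rewrite ltrDr.
Qed.

Lemma sum_prod_seq (m n : nat) (L : Type) (s : seq L) (c : L -> 'I_n -> R) :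
  (size s <= m)%N -> (forall l j, 0 <= c l j) -> (forall l, \sum_j c l j `^ m%:R <= 1) ->
  \sum_j \prod_(l <- s) c l j <= n%:R `^ (1 - (size s)%:R / m%:R).
Proof.
move=> sm c0 c1.
have csI x : List.In x (map c s) -> exists l, x = c l.
  by move=> /List.in_map_iff[l [<- _]]; exists l.
have P1 x : List.In x (map c s) -> forall i, 0 <= x i by move=> /csI[l ->].
have P2 x : List.In x (map c s) -> \sum_i x i `^ m%:R <= 1 by move=> /csI[l ->].
have := sum_prod_ball P1 P2 (w := fun=> 1); rewrite size_map => /(_ sm (fun=> ler01)).
rewrite sumr_const card_ord; apply: le_trans; apply: ler_sum => j _.
by rewrite big_map powR1 mulr1.
Qed.

Lemma sum_prod_pred (m n : nat) (P : pred 'I_m) (c : 'I_m -> 'I_n -> R) :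
  (forall l j, 0 <= c l j) -> (forall l, \sum_j c l j `^ m%:R <= 1) ->
  \sum_j \prod_(l | P l) c l j <= n%:R `^ (1 - #|P|%:R / m%:R).
Proof.
move=> c0 c1; rewrite cardE; apply: le_trans (sum_prod_seq _ c0 c1).
  by under eq_bigr do rewrite -big_enum.
by rewrite -cardE (leq_trans (max_card _)) ?card_ord.
Qed.

Lemma sum_prod_sqr_pred (m n : nat) (P : pred 'I_m) (c : 'I_m -> 'I_n -> R) :
  (2 * #|P| <= m)%N ->
  (forall l j, 0 <= c l j) -> (forall l, \sum_j c l j `^ m%:R <= 1) ->
  \sum_j (\prod_(l | P l) c l j) ^+ 2 <= n%:R `^ (1 - (2 * #|P|)%:R / m%:R).
Proof.
move=> Pm c0 c1; have sE : size (enum P ++ enum P) = (2 * #|P|)%N.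
  by rewrite size_cat -cardE mul2n addnn.
rewrite -sE; apply: le_trans (sum_prod_seq _ c0 c1); last by rewrite sE.
by apply: ler_sum => j _; rewrite big_cat/= !big_enum/= expr2.
Qed.

Section Sylvester.
Variables (K : fieldType) (abs : K -> R) (iota : {rmorphism R -> K}).
Hypothesis absP : is_modulus abs iota.

(** The exponent of [-1] in the entries of the Sylvester matrix of order [2^r], that is
    the parity of the scalar product of the binary expansions of [i] and [k]. *)
Fixpoint sylvester (r i k : nat) : bool :=
  if r is r'.+1 then (odd i && odd k) (+) sylvester r' i./2 k./2 else false.

Lemma sum_double (V : nmodType) N (F : nat -> V) :
  \sum_(i < N.*2) F i = \sum_(i < N) (F i.*2 + F i.*2.+1).
Proof.
elim: N => [|N IH]; first by rewrite !big_ord0.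
by rewrite doubleS !big_ord_recr/= IH addrA.
Qed.

(** Splitting [i] and [k] according to their last binary digit, this is the induction
    hypothesis for the sums and the differences of consecutive terms, followed by the
    parallelogram identity. *)
Lemma sylvester_parseval r (F : nat -> K) :
  \sum_(k < 2 ^ r) abs (\sum_(i < 2 ^ r) (-1) ^+ sylvester r i k * F i) ^+ 2 =
  (2 ^ r)%:R * \sum_(i < 2 ^ r) abs (F i) ^+ 2.
Proof.
elim: r F => [|r IH] F.
  by rewrite !big_ord1 /= !mul1r.
have E : (2 ^ r.+1 = (2 ^ r).*2)%N by rewrite expnS mul2n.
rewrite E (sum_double _ (fun k =>
  abs (\sum_(i < (2 ^ r).*2) (-1) ^+ sylvester r.+1 i k * F i) ^+ 2)).
rewrite (sum_double _ (fun i => abs (F i) ^+ 2)).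
have e0 (k : nat) : \sum_(i < (2 ^ r).*2) (-1) ^+ sylvester r.+1 i k.*2 * F i =
    \sum_(i < 2 ^ r) (-1) ^+ sylvester r i k * (F i.*2 + F i.*2.+1).
  rewrite (sum_double _ (fun i => (-1) ^+ sylvester r.+1 i k.*2 * F i)).
  by apply: eq_bigr => i _; rewrite /= !odd_double !andbF !doubleK uphalf_double mulrDr.
have e1 (k : nat) : \sum_(i < (2 ^ r).*2) (-1) ^+ sylvester r.+1 i k.*2.+1 * F i =
    \sum_(i < 2 ^ r) (-1) ^+ sylvester r i k * (F i.*2 - F i.*2.+1).
  rewrite (sum_double _ (fun i => (-1) ^+ sylvester r.+1 i k.*2.+1 * F i)).
  apply: eq_bigr => i _; rewrite /= !odd_double !doubleK !uphalf_double/=.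
  by rewrite signrN mulNr mulrBr.
under eq_bigr do rewrite e0 e1.
rewrite big_split/= (IH (fun i => F i.*2 + F i.*2.+1)) (IH (fun i => F i.*2 - F i.*2.+1)).
rewrite -mulrDr -big_split/= -mul2n natrM -mulrA mulrCA; congr (_ * _).
rewrite [RHS]big_distrr/=; apply: eq_bigr => i _; exact: (abs_parallelogram absP).
Qed.

Lemma sylvester_bilinear r (F G : 'I_(2 ^ r) -> K) :
  abs (\sum_(k < 2 ^ r) \sum_(i < 2 ^ r) (-1) ^+ sylvester r i k * F i * G k) <=
  Num.sqrt (2 ^ r)%:R * Num.sqrt (\sum_i abs (F i) ^+ 2) * Num.sqrt (\sum_k abs (G k) ^+ 2).
Proof.
pose F' (i : nat) := if insub i is Some j then F j else 0.
have FE (i : 'I_(2 ^ r)) : F i = F' i by rewrite /F' valK.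
pose H (k : 'I_(2 ^ r)) := \sum_(i < 2 ^ r) (-1) ^+ sylvester r i k * F i.
apply: (@le_trans _ _ (\sum_k abs (H k) * abs (G k))).
  apply: (le_trans (abs_sum absP _ _ _)); apply: ler_sum => k _.
  by rewrite -(absM absP) /H big_distrl.
apply: (le_trans (cauchy_schwarz_sum (fun k => abs_ge0 absP (H k)) (fun k => abs_ge0 absP (G k)))).
rewrite ler_wpM2r ?sqrtr_ge0// -sqrtrM ?ler0n//.
rewrite (_ : \sum_k abs (H k) ^+ 2 = (2 ^ r)%:R * \sum_i abs (F i) ^+ 2)//.
under [in RHS]eq_bigr do rewrite FE.
rewrite -sylvester_parseval; apply: eq_bigr => k _; congr (abs _ ^+ 2).
by apply: eq_bigr => i _; rewrite FE.
Qed.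

Section MonomialForm.
Variables (m n : nat) (Om : finType) (h : Om -> K) (sigma : 'I_m -> Om -> 'I_n).

(** A combination of monomials indexed by [Om]; when [sigma] separates the points of
    [Om], its coefficients are those of [h] and zeros. *)
Definition monomial_form (z : 'I_m -> 'rV[K]_n) : K :=
  \sum_w h w * \prod_l z l 0 (sigma l w).

Lemma monomial_form_ml : multilinear_form monomial_form.
Proof.
apply: ml_intro => z i c u v; rewrite /monomial_form big_distrr/= -big_split/=.
apply: eq_bigr => w _.
have E x : \prod_l upd z i x l 0 (sigma l w) =
    x 0 (sigma i w) * \prod_(l | l != i) z l 0 (sigma l w).
  rewrite (bigD1 i)//= /upd eqxx; congr (_ * _).
  by apply: eq_bigr => l /negbTE ->.
by rewrite !E !mxE; ring.
Qed.

Lemma monomial_form_coef w (js : m.-tuple 'I_n) :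
  (forall w', (forall l, sigma l w' = sigma l w) -> w' = w) ->
  (forall l, tnth js l = sigma l w) -> form_coef abs monomial_form js = abs (h w).
Proof.
move=> inj js_w; rewrite /form_coef /monomial_form; congr abs.
rewrite (bigD1 w)//= [X in _ * X]big1 => [|l _]; last by rewrite mxE js_w !eqxx.
rewrite mulr1 big1 ?addr0// => w' /eqP w'w.
have [l ll|e] := pickP [pred l | sigma l w' != sigma l w].
  by rewrite (bigD1 l)//= mxE eqxx/= js_w (negbTE ll) mul0r mulr0.
by exfalso; apply/w'w/inj => l; have /negbFE/eqP := e l.
Qed.
End MonomialForm.

Lemma card_ge m k : #|[pred l : 'I_m | (k <= l)%N]| = (m - k)%N.
Proof.
rewrite -sum1_card big_mkcond/=; elim: m => [|m IH]; first by rewrite big_ord0.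
by rewrite big_ord_recr/= IH inE /=; case: leqP => h; lia.
Qed.

Lemma abs_coord_le1 m n (v : 'rV[K]_n) j : (0 < m)%N ->
  \sum_j abs (v 0 j) `^ m%:R <= 1 -> abs (v 0 j) <= 1.
Proof.
move=> m0; apply: (ball_coord (p := m%:R) (z := fun j => abs (v 0 j))).
  by rewrite ltr0n.
by move=> ?; exact: (abs_ge0 absP).
Qed.

Lemma admissible_growth m (t : 'I_m -> \bar R) (al be : R) : (0 < m)%N ->
  admissible abs t ->
  (forall r, exists A : ('I_m -> 'rV[K]_(2 ^ r)) -> K,
     [/\ multilinear_form A, ball_bounded abs m%:R A ((2 ^ r)%:R `^ be) &
         (2 ^ r)%:R `^ al <= mixed_norm t (form_coef abs A)]) -> al <= be.
Proof.
move=> m0 [_ [C HC]] H; apply: (@growth `|C|) => r.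
have [A [mA bA lA]] := H r.
have n0 : (0 < 2 ^ r)%N by rewrite expn_gt0.
apply: (le_trans lA); apply: (le_trans (HC _ n0 A mA)).
apply: (@le_trans _ _ (`|C| * form_norm abs A)).
  by rewrite ler_wpM2r ?ler_norm// (form_norm_ge0 absP).
by rewrite ler_wpM2l// (form_norm_le absP).
Qed.

(** The test forms are
    [z_0(0) ... z_{k-1}(0) * sum_j z_k(j) ... z_{m-1}(j)], positions being counted
    from 0. *)
Lemma diagonal_sharp m (t : 'I_m -> \bar R) (k : 'I_m) :
  admissible abs t -> einv (t k) <= k%:R / m%:R.
Proof.
move=> adm; have m0 : (0 < m)%N by apply: leq_ltn_trans (ltn_ord k).
have mp : m%:R != 0 :> R by rewrite pnatr_eq0 -lt0n.
apply: (admissible_growth m0 adm) => r.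
have n0 : (0 < 2 ^ r)%N by rewrite expn_gt0.
pose j0 : 'I_(2 ^ r) := Ordinal n0.
pose sigma (l : 'I_m) (j : 'I_(2 ^ r)) := if (l < k)%N then j0 else j.
exists (monomial_form (fun=> 1) sigma); split; first exact: monomial_form_ml.
  move=> z z1; apply: (le_trans (abs_sum absP _ _ _)).
  have -> : k%:R / m%:R = 1 - #|[pred l : 'I_m | (k <= l)%N]|%:R / m%:R :> R.
    by rewrite card_ge natrB ?(ltnW (ltn_ord k))//; field.
  apply: le_trans (sum_prod_pred _ (fun l j => abs_ge0 absP (z l 0 j)) z1).
  apply: ler_sum => j _; rewrite mul1r (abs_prod absP) big_mkcond/= [leRHS]big_mkcond/=.
  apply: ler_prod => l _; rewrite (abs_ge0 absP)/= /sigma.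
  case: leqP => // lk.
  exact: (abs_coord_le1 j0 m0 (z1 l)).
have {1}-> : (2 ^ r)%:R `^ einv (t k) =
    \prod_(i < m) (if i == k :> nat then (2 ^ r)%:R `^ einv (t i) else 1).
  rewrite (bigD1 k)//= eqxx big1 ?mulr1// => i ik; rewrite ifF//.
  by apply/negbTE.
apply: (@mixed_norm_lower _ _ _ _ (fun i => i == k :> nat)
   (fun l s => if (l < k)%N then j0 else nth j0 s k)) => //.
- by move=> i; exact: adm.1.
- by move=> js; exact: (abs_ge0 absP).
move=> js hjs; rewrite (@monomial_form_coef _ _ _ _ _ (tnth js k)).
- by rewrite (abs1 absP).
- by move=> w' /(_ k); rewrite /sigma ltnn.
move=> l; rewrite /sigma.
have [lk|kl|lk] := ltngtP l k.
- by rewrite hjs ?lk// neq_ltn lk.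
- by rewrite hjs ?ltnNge ?(ltnW kl)//= ?gtn_eqF// nth_take// -tnth_nth.
- by congr tnth; apply: val_inj.
Qed.

(** The test forms are
    [z_0(0) ... z_{a-1}(0) * sum_{i,j} h(i,j) z_b(j) * prod_{l >= a, l <> b} z_l(i)]
    with [h] the Sylvester matrix.  Its operator norm on [l_2] is [n^(1/2)]; the product
    over [l] has [l_2] norm at most [n^(1/2 - (m-a-1)/m)], as [2(m-a-1) <= m], and [z_b]
    has [l_2] norm at most [n^(1/2 - 1/m)]. *)
Lemma sylvester_sharp m (t : 'I_m -> \bar R) (a b : 'I_m) :
  (a < b)%N -> (2 * (m - a.+1) <= m)%N ->
  admissible abs t -> einv (t a) + einv (t b) <= 2^-1 + a%:R / m%:R.
Proof.
move=> ab ma adm; have m0 : (0 < m)%N by apply: leq_ltn_trans (ltn_ord a).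
have m2 : (2 <= m)%N by have := ltn_ord b; lia.
have am := ltn_ord a.
have mp : m%:R != 0 :> R by rewrite pnatr_eq0 -lt0n.
pose P := [pred l : 'I_m | (a <= l)%N && (l != b)].
have cardP : #|P| = (m - a.+1)%N.
  have := cardD1 b [pred l : 'I_m | (a <= l)%N]; rewrite card_ge inE (ltnW ab).
  rewrite (eq_card (B := P)) => [|l]; last by rewrite !inE andbC.
  by rewrite add1n subnS => ->.
apply: (admissible_growth m0 adm) => r; set n := (2 ^ r)%N.
have n0 : (0 < n)%N by rewrite expn_gt0.
have nN0 : n%:R != 0 :> R by rewrite pnatr_eq0 -lt0n.
pose j0 : 'I_n := Ordinal n0.
pose sigma (l : 'I_m) (w : 'I_n * 'I_n) :=
  if l == b then w.2 else if (l < a)%N then j0 else w.1.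
exists (monomial_form (fun w : 'I_n * 'I_n => (-1) ^+ sylvester r w.1 w.2) sigma); split.
- exact: monomial_form_ml.
- move=> z z1; pose c l j := abs (z l 0 j).
  have c0 l j : 0 <= c l j by exact: (abs_ge0 absP).
  have c1 l : \sum_j c l j `^ m%:R <= 1 by exact: z1.
  pose F (i : 'I_n) := \prod_(l | l != b) z l 0 (if (l < a)%N then j0 else i).
  rewrite (_ : monomial_form _ _ _ =
    \sum_(k < n) \sum_(i < n) (-1) ^+ sylvester r i k * F i * z b 0 k); last first.
    rewrite exchange_big/= pair_big/=; apply: eq_bigr => -[i k] _ /=.
    rewrite (bigD1 b)//= /sigma eqxx/= -mulrA; congr (_ * _); rewrite mulrC; congr (_ * _).
    by apply: eq_bigr => l /negbTE ->.
  apply: (le_trans (sylvester_bilinear F (fun k => z b 0 k))).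
  have F2 : \sum_i abs (F i) ^+ 2 <= n%:R `^ (1 - (2 * (m - a.+1))%:R / m%:R).
    rewrite -cardP; have Pm : (2 * #|P| <= m)%N by rewrite cardP.
    apply: le_trans (sum_prod_sqr_pred Pm c0 c1); apply: ler_sum => i _.
    rewrite lerXn2r ?nnegrE ?(abs_ge0 absP)//; first by apply: prodr_ge0.
    rewrite (abs_prod absP) big_mkcond/= [leRHS]big_mkcond/=; apply: ler_prod => l _.
    rewrite (fun_if (fun x => 0 <= x)) (abs_ge0 absP) ler01 if_same/= andbC.
    case: (l =P b) => //= _; case: ltnP => // la.
    exact: (abs_coord_le1 j0 m0 (z1 l)).
  have G2 : \sum_k abs (z b 0 k) ^+ 2 <= n%:R `^ (1 - 2 / m%:R).
    have Pm : (2 * #|pred1 b| <= m)%N by rewrite card1.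
    have := sum_prod_sqr_pred Pm c0 c1; rewrite card1 muln1.
    by under eq_bigr do rewrite big_pred1_eq.
  have root (x e : R) : 0 <= x -> x <= n%:R `^ e -> Num.sqrt x <= n%:R `^ (e / 2).
    move=> x0 xe; rewrite powRrM powR12_sqrt ?powR_ge0// ler_wsqrtr//.
  apply: (@le_trans _ _ (n%:R `^ (1 / 2) * n%:R `^ ((1 - (2 * (m - a.+1))%:R / m%:R) / 2) *
      n%:R `^ ((1 - 2 / m%:R) / 2))).
    rewrite ler_pM ?mulr_ge0 ?sqrtr_ge0//; last first.
      by apply: root G2; apply: sumr_ge0 => k _; rewrite exprn_ge0// (abs_ge0 absP).
    rewrite ler_pM ?sqrtr_ge0//; last first.
      by apply: root F2; apply: sumr_ge0 => k _; rewrite exprn_ge0// (abs_ge0 absP).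
    by apply: root; rewrite ?ler0n// powRr1.
  rewrite -!(@powRD _ n%:R) ?nN0 ?implybT// le_eqVlt; apply/orP; left; apply/eqP.
  congr (_ `^ _); rewrite natrM natrB// -natr1; by field.
have ba : (b == a :> nat) = false by rewrite gtn_eqF.
have {1}-> : (2 ^ r)%:R `^ (einv (t a) + einv (t b)) =
    \prod_(i < m) (if (i == a :> nat) || (i == b :> nat) then n%:R `^ einv (t i) else 1).
  have bNa : b != a by apply/negbT.
  rewrite (bigD1 a)//= eqxx (bigD1 b)//= eqxx orbT.
  rewrite big1 ?mulr1 => [|i /andP[/negbTE ia /negbTE ib]]; last first.
    by rewrite -val_eqE /= in ia; rewrite -val_eqE /= in ib; rewrite ia ib.
  by rewrite (@powRD _ n%:R) ?nN0 ?implybT.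
apply: (@mixed_norm_lower _ _ _ _ (fun i => (i == a :> nat) || (i == b :> nat))
   (fun l s => if (l < a)%N then j0 else nth j0 s a)) => //.
- by move=> i; exact: adm.1.
- by move=> js; exact: (abs_ge0 absP).
move=> js hjs; rewrite (@monomial_form_coef _ _ _ _ _ (tnth js a, tnth js b)).
- by rewrite (abs_sign absP).
- move=> [i k] e; have := e a; have := e b.
  by rewrite /sigma eqxx -val_eqE /= eq_sym ba ltnn => -> ->.
move=> l; rewrite /sigma; case: (l =P b) => [->//|/eqP lb].
have lb' : (l == b :> nat) = false by apply/negbTE.
have [la|al|la] := ltngtP l a.
- by rewrite hjs ?la// lb' orbF neq_ltn la.
- by rewrite hjs ?lb' ?orbF ?ltnNge ?(ltnW al)//= ?gtn_eqF// nth_take// -tnth_nth.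
- by congr tnth; apply: val_inj.
Qed.
End Sylvester.
End LowerBound.

Lemma einv_le (R : realType) (t : \bar R) (s : R) : (0 < t)%E -> 0 < s ->
  einv t <= s^-1 -> (s%:E <= t)%E.
Proof.
case: t => [r||] //=; last by rewrite leey.
by rewrite lte_fin lee_fin => r0 s0; rewrite lef_pV2 ?posrE.
Qed.

Section Main.
Variables (R : realType) (K : fieldType) (abs : K -> R) (iota : {rmorphism R -> K}).
Hypothesis absP : is_modulus abs iota.
Variable m : nat.
Hypothesis m2 : (2 <= m)%N.

Lemma s_exp_sharp (k : 'I_m) : (k.+1 <= k0 m)%N -> sharp_at abs (@s_exp R m) k.
Proof.
move=> kk t adm; have t0 := adm.1 k; have := diagonal_sharp absP k adm.
rewrite /s_exp kk; case: eqP => [->|/eqP kN0].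
  rewrite mul0r; case: (t k) t0 => [r||] //=.
  by rewrite lte_fin => r0; rewrite leNgt invr_gt0 r0.
move=> h; apply: einv_le => //; last by rewrite invf_div.
by rewrite divr_gt0// ltr0n; lia.
Qed.

Lemma s_exp_gt0 (i : 'I_m) : (0 < @s_exp R m i)%E.
Proof.
rewrite /s_exp; case: eqP => // /eqP i0; case: ifP => _; rewrite lte_fin ?ltr0n//.
by rewrite divr_gt0// ltr0n; lia.
Qed.

Lemma s_exp_globally_sharp : globally_sharp abs (@s_exp R m).
Proof.
split; first by split; [exact: s_exp_gt0|exact (s_exp_inequality absP m2)].
move=> j t' t'0 t's adm.
have [jk|kj] := leqP j.+1 (k0 m).
  have := s_exp_sharp jk adm; rewrite /= eqxx => /le_lt_trans/(_ t's).
  by rewrite ltxx.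
have k0m : (2 <= k0 m <= m)%N by rewrite /k0; lia.
have ak : ((k0 m).-1 < m)%N by lia.
pose a := Ordinal ak.
have aj : ((k0 m).-1 < j)%N by lia.
have ma : (2 * (m - a.+1) <= m)%N by rewrite /= /k0; lia.
have := @sylvester_sharp R _ _ _ absP m _ a j aj ma adm; rewrite /= eqxx ifF; last first.
  by apply/negbTE; rewrite -val_eqE /= neq_ltn aj.
have -> : einv (@s_exp R m a) = (k0 m).-1%:R / m%:R.
  rewrite /s_exp ifF /=; last by lia.
  by rewrite ifT /= ?invf_div//; lia.
rewrite addrC lerD2r; case: t' t'0 t's {adm} => [r| _|] /=; [|by rewrite ltNge leey|by []].
rewrite lte_fin /s_exp ifF; last by lia.
rewrite ifF; last by lia.
by rewrite lte_fin => r0 r2; rewrite lef_pV2 ?posrE// leNgt r2.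
Qed.
End Main.

Theorem corollary6p3 (R : realType) (F : scalars) (m : nat) (hm : (2 <= m)%N) :
  (exists C : R, forall n : nat, (0 < n)%N ->
     forall A : ('I_m -> 'rV[scalar_type R F]_n) -> scalar_type R F,
       multilinear_form A ->
       (mixed_norm (@s_exp R m) (form_coef (@modulus R F) A)
          <= C * form_norm (@modulus R F) A)%R) /\
  (forall k : 'I_m, (k.+1 <= k0 m)%N ->
     sharp_at (@modulus R F) (@s_exp R m) k) /\
  globally_sharp (@modulus R F) (@s_exp R m).
Proof.
have [iota absP] : exists iota : {rmorphism R -> scalar_type R F},
    is_modulus (@modulus R F) iota.
  by case: F; [exists idfun; exact: modulus_real|
               exists (real_complex R); exact: modulus_complex].
split; first exact (s_exp_inequality absP hm).
split; [exact (s_exp_sharp absP hm)|exact (s_exp_globally_sharp absP hm)].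
Qed.
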